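(* Let $f:\mathbb{R}^n\to\mathbb{R}$ be convex, twice differentiable and $L$-smooth, let $g:\mathbb{R}^n\to\mathbb{R}\cup\{+\infty\}$ be proper, closed and convex, and let $0\le\mu\le L$, $L>0$, $\gamma\in(0,\tfrac1L]$. Let $F^{\mathrm{FB}}_\gamma$ and $F^{\mathrm{DR}}_\gamma$ be the forward-backward and Douglas-Rachford envelopes of $f+g$ (see context). Suppose one of the following holds. (A) There are a convex set $\Omega_f\subseteq\mathbb{R}^n$ and constants $H,D,G\ge 0$ such that $\mu I\preceq\nabla^2 f(x)\preceq LI$ and $\|\nabla f(x)\|\le D$ for every $x\in\Omega_f$, $\|\nabla^2 f(x)-\nabla^2 f(y)\|\le H\|x-y\|$ for all $x,y\in\Omega_f$, and $g$ is (real-valued and) $G$-Lipschitz continuous on $\mathbb{R}^n$. Moreover $\Omega\subseteq\mathbb{R}^n$ is convex, with $\Omega\subseteq\Omega_f$ in the FB case and $\operatorname{prox}_{\gamma f}(\Omega)\subseteq\Omega_f$ in the DR case. (B) $f$ is a quadratic function whose Hessian $Q$ satisfies $\mu I\preceq Q\preceq LI$. In this case put $\Omega=\mathbb{R}^n$ and replace $H(D+G)$ by $0$ in all constants below. Then the corresponding envelope $F_\gamma\in\{F_\gamma^{\mathrm{FB}},F_\gamma^{\mathrm{DR}}\}$ is $L_\gamma$-smooth and $\mu_\gamma$-convex on $\Omega$, where $$L_{\gamma}^{\mathrm{FB}}=\frac{1-\gamma\mu}{\gamma}+\gamma H(D+G),\qquad \mu_{\gamma}^{\mathrm{FB}}=\min\{\mu(1-\gamma\mu),\,L(1-\gamma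 L)\}-\gamma H(D+G),$$ $$L_{\gamma}^{\mathrm{DR}}=\frac{1-\gamma\mu}{\gamma(1+\gamma\mu)^2}+\frac{2\gamma H(D+G)}{(1+\gamma\mu)^3},\qquad \mu_{\gamma}^{\mathrm{DR}}=\min\left\{\frac{\mu(1-\gamma\mu)}{(1+\gamma\mu)^2},\frac{L(1-\gamma L)}{(1+\gamma L)^2}\right\}-\frac{2\gamma H(D+G)}{(1+\gamma\mu)^3}.$$
   Context: $\|\cdot\|$ is the Euclidean norm for vectors and the operator norm for matrices. For $h$ proper, closed, convex and $\gamma>0$: $\operatorname{prox}_{\gamma h}(z)=\arg\min_x\{h(x)+\frac1{2\gamma}\|x-z\|^2\}$, and the Moreau envelope is $h_\gamma(z)=\min_x\{h(x)+\frac1{2\gamma}\|x-z\|^2\}$, which is convex and continuously differentiable with $\nabla h_\gamma(z)=\frac1\gamma(z-\operatorname{prox}_{\gamma h}(z))$. The envelopes are $$F^{\mathrm{FB}}_{\gamma}(x)=f(x)-\tfrac{\gamma}{2}\|\nabla f(x)\|^2+g_{\gamma}(x-\gamma\nabla f(x)),$$ $$F^{\mathrm{DR}}_{\gamma}(x)=f_{\gamma}(x)-\gamma\|\nabla f_{\gamma}(x)\|^2+g_{\gamma}(x-2\gamma\nabla f_{\gamma}(x)).$$ A differentiable function is $\ell$-smooth on a set if its gradient is $\ell$-Lipschitz on that set ($\ell$-smooth without qualification: on $\mathbb{R}^n$). A function $h$ is $m$-convex on a convex set $\Omega$ ($m\in\mathbb{R}$, possibly negative) if $x\mapsto h(x)-\frac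 m2\|x\|^2$ is convex on $\Omega$. *)

(* Defs.v *)
From HB Require Import structures.
From mathcomp Require Import all_boot all_order all_algebra.
From mathcomp Require Import all_classical all_reals all_analysis.
Set Implicit Arguments.
Unset Strict Implicit.
Unset Printing Implicit Defensive.
Import Order.TTheory GRing.Theory Num.Theory.
Import numFieldNormedType.Exports.
Local Open Scope classical_set_scope.
Local Open Scope ring_scope.

(* Vectors of R^n are row vectors.  The library norm `|x| on 'rV[R]_n is the
   sup norm, so the Euclidean norm is introduced separately; differentiability
   and topology are those of the library, which do not depend on this choice. *)

Definition dot (R : realType) (n : nat) (u v : 'rV[R]_n) : R :=
  \sum_(i < n) u 0 i * v 0 i.

Definition enorm (R : realType) (n : nat) (x : 'rV[R]_n) : R :=
  Num.sqrt (dot x x).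

Definition opnorm (R : realType) (n : nat) (A : 'M[R]_n) : R :=
  sup [set enorm (x *m A) | x in [set x : 'rV[R]_n | enorm x <= 1]].

(* Symmetry is not part of the definition: the order is only applied to
   multiples of the identity and to Hessians of twice differentiable
   functions, which are symmetric. *)
Definition loewner_le (R : realType) (n : nat) (A B : 'M[R]_n) : Prop :=
  forall v : 'rV[R]_n, 0 <= dot (v *m (B - A)) v.

Definition grad (R : realType) (n : nat) (f : 'rV[R]_n -> R) (x : 'rV[R]_n)
    : 'rV[R]_n :=
  \row_(i < n) 'D_(delta_mx 0 i) f x.

Definition hessian (R : realType) (n : nat) (f : 'rV[R]_n -> R) (x : 'rV[R]_n)
    : 'M[R]_n :=
  'J (grad f) x.

Definition twice_differentiable (R : realType) (n : nat)
    (f : 'rV[R]_n -> R) : Prop :=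
  (forall x, differentiable f x) /\ (forall x, differentiable (grad f) x).

Definition smooth_on (R : realType) (n : nat) (l : R) (S : set 'rV[R]_n)
    (f : 'rV[R]_n -> R) : Prop :=
  (forall x, differentiable f x) /\
  (forall x y, S x -> S y ->
    enorm (grad f x - grad f y) <= l * enorm (x - y)).

Definition mconvex_on (R : realType) (n : nat) (m : R) (S : set 'rV[R]_n)
    (f : 'rV[R]_n -> R) : Prop :=
  convex_function S (fun x => f x - m / 2 * enorm x ^+ 2).

Definition quadratic (R : realType) (n : nat) (f : 'rV[R]_n -> R) : Prop :=
  exists (A : 'M[R]_n) (b : 'rV[R]_n) (c : R),
    forall x, f x = 2^-1 * dot (x *m A) x + dot b x + c.

Definition proper_efun (R : realType) (n : nat) (h : 'rV[R]_n -> \bar R) : Prop :=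
  (forall x, h x != -oo%E) /\ (exists x, h x != +oo%E).

Definition closed_efun (R : realType) (n : nat) (h : 'rV[R]_n -> \bar R) : Prop :=
  closed [set p : 'rV[R]_n * R | (h p.1 <= p.2%:E)%E].

(* Only meant for functions that do not take the value -oo; the endpoints
   t = 0, 1 are harmless since 0 * +oo = 0. *)
Definition convex_efun (R : realType) (n : nat) (h : 'rV[R]_n -> \bar R) : Prop :=
  forall (x y : 'rV[R]_n) (t : R), 0 <= t -> t <= 1 ->
    (h (t *: x + (1 - t) *: y)%R <= t%:E * h x + (1 - t)%:E * h y)%E.

Definition real_lipschitz (R : realType) (n : nat) (G : R)
    (g : 'rV[R]_n -> \bar R) : Prop :=
  (forall x, g x \is a fin_num) /\
  (forall x y, `|fine (g x) - fine (g y)| <= G * enorm (x - y)).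

Definition prox_obj (R : realType) (n : nat) (gamma : R)
    (h : 'rV[R]_n -> \bar R) (z x : 'rV[R]_n) : \bar R :=
  (h x + ((2 * gamma)^-1 * enorm (x - z) ^+ 2)%:E)%E.

(* The minimizer exists and is unique when h is proper, closed and convex and
   gamma > 0, so that the choice made by [get] is immaterial. *)
Definition prox (R : realType) (n : nat) (gamma : R)
    (h : 'rV[R]_n -> \bar R) (z : 'rV[R]_n) : 'rV[R]_n :=
  get [set x | forall y, (prox_obj gamma h z x <= prox_obj gamma h z y)%E].

(* For h proper, closed, convex and gamma > 0 the infimum is finite and
   attained, so that [fine] loses nothing. *)
Definition moreau (R : realType) (n : nat) (gamma : R)
    (h : 'rV[R]_n -> \bar R) (z : 'rV[R]_n) : R :=
  fine (ereal_inf (range (prox_obj gamma h z))).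

Definition FBE (R : realType) (n : nat) (gamma : R)
    (f : 'rV[R]_n -> R) (g : 'rV[R]_n -> \bar R) (x : 'rV[R]_n) : R :=
  f x - gamma / 2 * enorm (grad f x) ^+ 2
  + moreau gamma g (x - gamma *: grad f x).

Definition DRE (R : realType) (n : nat) (gamma : R)
    (f : 'rV[R]_n -> R) (g : 'rV[R]_n -> \bar R) (x : 'rV[R]_n) : R :=
  let fgamma := moreau gamma (EFin \o f) in
  fgamma x - gamma * enorm (grad fgamma x) ^+ 2
  + moreau gamma g (x - (2 * gamma) *: grad fgamma x).

(* In the four constants below, K is H (D + G), or 0 when f is quadratic. *)
Definition L_FB (R : realType) (mu gamma K : R) : R :=
  (1 - gamma * mu) / gamma + gamma * K.

Definition mu_FB (R : realType) (mu L gamma K : R) : R :=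
  Num.min (mu * (1 - gamma * mu)) (L * (1 - gamma * L)) - gamma * K.

Definition L_DR (R : realType) (mu gamma K : R) : R :=
  (1 - gamma * mu) / (gamma * (1 + gamma * mu) ^+ 2)
  + 2 * gamma * K / (1 + gamma * mu) ^+ 3.

Definition mu_DR (R : realType) (mu L gamma K : R) : R :=
  Num.min (mu * (1 - gamma * mu) / (1 + gamma * mu) ^+ 2)
          (L * (1 - gamma * L) / (1 + gamma * L) ^+ 2)
  - 2 * gamma * K / (1 + gamma * mu) ^+ 3.

(* Main.v *)
Require Import Defs.
From HB Require Import structures.
From mathcomp Require Import all_boot all_order all_algebra.
From mathcomp Require Import all_classical all_reals all_analysis.
From mathcomp Require Import ring lra.
Set Implicit Arguments.
Unset Strict Implicit.
Unset Printing Implicit Defensive.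
Import Order.TTheory GRing.Theory Num.Theory.
Import numFieldNormedType.Exports.
Local Open Scope classical_set_scope.
Local Open Scope ring_scope.

(* Both envelopes are handled at once with a parameter tau and a map p such
   that p x + tau grad f (p x) = x: tau = 0, p = id for FB, and tau = gamma,
   p = prox_{gamma f} for DR, because DRE x = FBE (p x).  With
   a z = z - prox_{gamma g} (z - gamma grad f z), A = hess f and
   S(A) = (1 - gamma A) (1 + tau A)^-1, the gradient of the envelope at x is
   a (p x) S(A (p x)) / gamma.  For two points x, y let M be the mean of the
   Hessian over the segment from p y to p x, so that grad f (p x) - grad f (p y)
   = (p x - p y) M holds exactly.  The difference of the gradients is then
   (a (p x) - a (p y)) S(M) / gamma, controlled by the firm nonexpansiveness of
   prox_{gamma g} and by spectral bounds for M, plus two errors in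
   S(A (p x)) - S(M) and S(A (p y)) - S(M).  Each of them costs H / 2 times
   |p x - p y| by the Lipschitz continuity of the Hessian, and together they
   give the term H (D + G). *)

(** The obstacle is that firm nonexpansiveness concerns a difference of values of a nonlinear map,
    while sharp constants need functional calculus in one symmetric matrix. The mean value theorem
    gives a different intermediate point for each test direction. With [M], the differences [x - y]
    and [(p x - gamma grad f (p x)) - (p y - gamma grad f (p y))] are [e (1 + tau M)] and
    [e (1 - gamma M)] for the single vector [e = p x - p y]. The spectral estimates then become
    inequalities for concave polynomials of degree at most two on [[mu, L]], to be checked at the
    two endpoints only; hence the minimum over [mu] and [L] in the convexity constants. The factor
    [gamma + tau], equal to [gamma] or [2 gamma], comes from the resolvent identity for
    [S(A) - S(B)]. Its two resolvents give two powers of [1 + tau mu]; the third is the price of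
    replacing [|e|] by [|x - y|]. Finally [a z = gamma grad f z + (w - prox w)] with
    [w = z - gamma grad f z], and the two summands have norms at most [gamma D] and [gamma G]. *)

Lemma discr_le0_of_form_ge0 (R : realFieldType) (X Y Z : R) :
  (forall s t, 0 <= s ^+ 2 * X + 2 * s * t * Y + t ^+ 2 * Z) -> Y ^+ 2 <= X * Z.
Proof.
move=> q; have Z0 : 0 <= Z by have := q 0 1; lra.
have X0 : 0 <= X by have := q 1 0; lra.
have [Ze|Zn] := eqVneq Z 0.
  (* At this point the form equals [- Y ^+ 2 * (X + 2)], which forces [Y = 0]. *)
  by have := q (- Y) (X + 1); rewrite Ze; nra.
have Zp : 0 < Z by rewrite lt_neqAle eq_sym Zn.
(* Here the form equals [Z * (X * Z - Y ^+ 2)]. *)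
by rewrite -(ler_pM2l Zp); have := q Z (- Y); lra.
Qed.

Lemma affine_ge0 (R : realFieldType) (a b y p q : R) : a <= y -> y <= b ->
  0 <= p + q * a -> 0 <= p + q * b -> 0 <= p + q * y.
Proof. by case: (leP 0 q) => q0; nra. Qed.

(** * Euclidean geometry of row vectors and quadratic forms *)

Section Euclidean.
Context {R : realType} {n : nat}.
Implicit Types (u v w x y : 'rV[R]_n) (A B : 'M[R]_n) (a b c : R).

Lemma dotC u v : dot u v = dot v u.
Proof. by apply: eq_bigr => i _; rewrite mulrC. Qed.

Lemma dotDl u v w : dot (u + v) w = dot u w + dot v w.
Proof. by rewrite /dot -big_split/=; apply: eq_bigr => i _; rewrite mxE mulrDl. Qed.

Lemma dotDr u v w : dot w (u + v) = dot w u + dot w v.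
Proof. by rewrite dotC dotDl !(dotC w). Qed.

Lemma dotZl a u v : dot (a *: u) v = a * dot u v.
Proof. by rewrite /dot mulr_sumr; apply: eq_bigr => i _; rewrite mxE mulrA. Qed.

Lemma dotZr a u v : dot u (a *: v) = a * dot u v.
Proof. by rewrite dotC dotZl dotC. Qed.

Lemma dotNl u v : dot (- u) v = - dot u v.
Proof. by rewrite -scaleN1r dotZl mulN1r. Qed.

Lemma dotNr u v : dot u (- v) = - dot u v.
Proof. by rewrite dotC dotNl dotC. Qed.

Lemma dotBl u v w : dot (u - v) w = dot u w - dot v w.
Proof. by rewrite dotDl dotNl. Qed.

Lemma dot0l u : dot 0 u = 0.
Proof. by rewrite -(scale0r 0) dotZl mul0r. Qed.

Lemma dot0r u : dot u 0 = 0.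
Proof. by rewrite dotC dot0l. Qed.

Definition dotE := (dotDl, dotDr, dotNl, dotNr, dotZl, dotZr, dot0l, dot0r).

Lemma dot_mulmxl A u v : dot (u *m A) v = dot u (v *m A^T).
Proof.
rewrite /dot; under eq_bigr => i _ do rewrite mxE mulr_suml.
rewrite exchange_big/=; apply: eq_bigr => j _; rewrite mxE mulr_sumr.
by apply: eq_bigr => i _; rewrite mxE; ring.
Qed.

Lemma dot_sym A u v : A^T = A -> dot (u *m A) v = dot u (v *m A).
Proof. by rewrite dot_mulmxl => ->. Qed.

Lemma dot_delta u i : dot u (delta_mx 0 i) = u 0 i.
Proof.
rewrite /dot (bigD1 i)//= big1 => [|j ji]; rewrite mxE !eqxx/= ?mulr1 ?addr0//.
by rewrite (negPf ji) mulr0.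
Qed.

Lemma dot_inj u v : (forall w, dot u w = dot v w) -> u = v.
Proof. by move=> h; apply/rowP => i; rewrite -!dot_delta h. Qed.

Lemma dot_ge0 u : 0 <= dot u u.
Proof. by apply: sumr_ge0 => i _; rewrite -expr2 sqr_ge0. Qed.

Lemma dot_eq0 u : dot u u = 0 -> u = 0.
Proof.
move=> u0; apply/rowP => i; rewrite mxE; apply/eqP; rewrite -sqrf_eq0 expr2.
move/eqP: u0; rewrite /dot psumr_eq0 => [|j _]; last by rewrite -expr2 sqr_ge0.
by move=> /allP/(_ i)/=; rewrite mem_index_enum => /(_ isT).
Qed.

Lemma enorm_ge0 u : 0 <= enorm u. Proof. exact: sqrtr_ge0. Qed.

Lemma sqr_enorm u : enorm u ^+ 2 = dot u u.
Proof. by rewrite sqr_sqrtr// dot_ge0. Qed.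

Lemma enorm0 : enorm (0 : 'rV[R]_n) = 0.
Proof. by rewrite /enorm dot0l sqrtr0. Qed.

Lemma enorm_eq0 u : enorm u = 0 -> u = 0.
Proof. by move=> u0; apply: dot_eq0; rewrite -sqr_enorm u0 expr0n. Qed.

Lemma enormZ a u : enorm (a *: u) = `|a| * enorm u.
Proof. by rewrite /enorm dotZl dotZr mulrA -expr2 sqrtrM ?sqr_ge0// sqrtr_sqr. Qed.

Lemma enormN u : enorm (- u) = enorm u.
Proof. by rewrite -scaleN1r enormZ normrN1 mul1r. Qed.

Lemma enormBC u v : enorm (u - v) = enorm (v - u).
Proof. by rewrite -enormN opprB. Qed.

Lemma enorm_leP u a : 0 <= a -> (enorm u <= a) = (dot u u <= a ^+ 2).
Proof. by move=> a0; rewrite -sqr_enorm ler_sqr ?nnegrE ?enorm_ge0. Qed.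

(** Semidefinite forms are allowed because two instances matter: the identity, for the usual
    inequality, and a shifted matrix [A - a], whose form may degenerate. *)
Lemma psd_cauchy_schwarz A u v : A^T = A -> (forall w, 0 <= dot (w *m A) w) ->
  dot (u *m A) v ^+ 2 <= dot (u *m A) u * dot (v *m A) v.
Proof.
move=> sA pA; apply: discr_le0_of_form_ge0 => s t.
have vuA : dot (v *m A) u = dot (u *m A) v by rewrite dot_sym// dotC.
have := pA (s *: u + t *: v).
rewrite mulmxDl -!scalemxAl !dotE vuA; lra.
Qed.

Lemma cauchy_schwarz u v : `|dot u v| <= enorm u * enorm v.
Proof.
rewrite -ler_sqr ?nnegrE ?normr_ge0 ?mulr_ge0 ?enorm_ge0//.
rewrite real_normK ?num_real// exprMn !sqr_enorm.
have := @psd_cauchy_schwarz 1%:M u v (trmx1 _ _); rewrite !mulmx1; apply => w.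
by rewrite mulmx1 dot_ge0.
Qed.

Lemma dot_le_enorm u v : dot u v <= enorm u * enorm v.
Proof. exact: le_trans (ler_norm _) (cauchy_schwarz u v). Qed.

Lemma enormD u v : enorm (u + v) <= enorm u + enorm v.
Proof.
rewrite enorm_leP ?addr_ge0 ?enorm_ge0// sqrrD !sqr_enorm !dotE (dotC v u).
have := dot_le_enorm u v; lra.
Qed.

Lemma enormB u v : enorm (u - v) <= enorm u + enorm v.
Proof. by rewrite -(enormN v) enormD. Qed.

Lemma enorm_le_dual u c : 0 <= c -> (forall w, dot u w <= c * enorm w) ->
  enorm u <= c.
Proof.
move=> c0 /(_ u); rewrite -sqr_enorm expr2 => h.
have [u0|u0] := eqVneq (enorm u) 0; first by rewrite u0.
by move: h; rewrite ler_pM2r// lt_neqAle eq_sym u0 enorm_ge0.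
Qed.

Lemma coord_le_enorm u i : `|u 0 i| <= enorm u.
Proof.
rewrite -(dot_delta u i) (le_trans (cauchy_schwarz _ _))//.
by rewrite {2}/enorm dot_delta mxE !eqxx sqrtr1 mulr1.
Qed.

Lemma mx_norm_le_enorm u : `|u| <= enorm u.
Proof.
rewrite [leLHS]/Num.norm/= mx_normrE; apply/bigmax_leP; split; first exact: enorm_ge0.
by case=> i j _/=; rewrite (ord1 i) coord_le_enorm.
Qed.

Lemma coord_le_mx_norm u i : `|u 0 i| <= `|u|.
Proof. by rewrite [leRHS]/Num.norm/= mx_normrE; exact: (le_bigmax _ _ (0, i)). Qed.

(** Only equivalence with the sup norm matters, so the constant is crude; [n.+1] keeps it positive
    in dimension 0, where it is still used as a divisor. *)
Lemma enorm_le_mx_norm u : enorm u <= n.+1%:R * `|u|.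
Proof.
rewrite enorm_leP ?mulr_ge0//.
have : dot u u <= \sum_(i < n) `|u| ^+ 2.
  apply: ler_sum => i _; rewrite -expr2 -[leLHS]real_normK ?num_real//.
  by rewrite ler_sqr ?nnegrE// coord_le_mx_norm.
rewrite sumr_const card_ord => /le_trans; apply; rewrite exprMn -[leLHS]mulr_natl.
by rewrite ler_wpM2r ?sqr_ge0// -natrX ler_nat (leq_trans (leqnSn n))// leq_pmulr.
Qed.

Lemma trmx_loewner A a : A^T = A -> (A - a%:M)^T = A - a%:M.
Proof. by move=> sA; rewrite linearB/= tr_scalar_mx sA. Qed.

Lemma loewner_geE A a v : loewner_le a%:M A -> a * dot v v <= dot (v *m A) v.
Proof. by move=> /(_ v); rewrite mulmxBr mul_mx_scalar !dotE subr_ge0. Qed.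

Lemma loewner_leE A a v : loewner_le A a%:M -> dot (v *m A) v <= a * dot v v.
Proof. by move=> /(_ v); rewrite mulmxBr mul_mx_scalar !dotE subr_ge0. Qed.

(* Functional calculus for concave quadratics: it rests on
   [(A - a)(b - A) >= 0], that is on [B ^ 2 <= (b - a) B] for [B := A - a]. *)
Lemma concave_quadratic_ge0 A a b c0 c1 k v : a <= b -> A^T = A ->
  loewner_le a%:M A -> loewner_le A b%:M -> 0 <= k ->
  0 <= c0 + c1 * a - k * a ^+ 2 -> 0 <= c0 + c1 * b - k * b ^+ 2 ->
  0 <= c0 * dot v v + c1 * dot (v *m A) v - k * dot (v *m A) (v *m A).
Proof.
move=> ab sA aA Ab k0 ha hb.
have sB := trmx_loewner a sA; set B := A - a%:M in sB.
have pB w : 0 <= dot (w *m B) w by exact: aA.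
(* Cauchy-Schwarz for the form of [B] at [v] and [v *m B] gives [X ^+ 2 <= Y * Z] with
   [Z <= (b - a) * X]; then [X] is cancelled. *)
have hBB : dot (v *m B) (v *m B) <= (b - a) * dot (v *m B) v.
  have := psd_cauchy_schwarz v (v *m B) sB pB.
  have : dot (v *m B *m B) (v *m B) <= (b - a) * dot (v *m B) (v *m B).
    rewrite {2}/B mulmxBr mul_mx_scalar dotBl dotZl mulrBl lerB//.
    exact: loewner_leE.
  have := pB v; have := dot_ge0 (v *m B).
  set X := dot (v *m B) (v *m B); set Y := dot (v *m B) v.
  set Z := dot _ _ => X0 Y0 hZ hX.
  have [->|Xn0] := eqVneq X 0; first by rewrite mulr_ge0 ?subr_ge0.
  have Xp : 0 < X by rewrite lt_neqAle eq_sym Xn0.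
  rewrite -(ler_pM2r Xp) -expr2 (le_trans hX)//.
  by rewrite -mulrA (mulrC (b - a)) -mulrA ler_wpM2l// (mulrC X).
have hA : dot (v *m A) (v *m A) <=
    (a + b) * dot (v *m A) v - a * b * dot v v.
  move: hBB; rewrite /B mulmxBr mul_mx_scalar !dotE (dotC v (v *m A)); lra.
have := loewner_geE v aA; have := loewner_leE v Ab.
move: hA; have := dot_ge0 v.
set Z := dot v v; set Y := dot _ v; set X := dot _ _ => Z0 hX hY1 hY2.
(* This is the chord of the quadratic over [[a, b]]: it agrees with it at [a] and [b] and lies below
   it in between. Being affine in [Y], it is checked at [Y = a * Z] and [Y = b * Z]. *)
have : 0 <= (c0 + k * a * b) * Z + (c1 - k * (a + b)) * Y.
  apply: (affine_ge0 hY2 hY1).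
    have := mulr_ge0 ha Z0; lra.
  have := mulr_ge0 hb Z0; lra.
have := ler_wpM2l k0 hX; lra.
Qed.

End Euclidean.

(** * The resolvent of a matrix bounded below *)

Section Resolvent.
Context {R : realType} {n : nat}.
Variables (mu L tau : R).
Hypotheses (mu_ge0 : 0 <= mu) (mu_le_L : mu <= L) (tau_ge0 : 0 <= tau).
Implicit Types (u v w : 'rV[R]_n) (A : 'M[R]_n).

Definition resolvent A : 'M[R]_n := invmx (1%:M + tau *: A).

Let den_gt0 : 0 < 1 + tau * mu.
Proof. by rewrite ltr_wpDr// mulr_ge0. Qed.

Lemma mulmx_shift (c : R) A v : v *m (1%:M + c *: A) = v + c *: (v *m A).
Proof. by rewrite mulmxDr mulmx1 scalemxAr. Qed.

(** Pairing the image with [v] itself and applying Cauchy-Schwarz. This one bound yields both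
    invertibility, through a trivial kernel, and the norm of the resolvent. *)
Lemma enorm_shift_ge A v : loewner_le mu%:M A ->
  (1 + tau * mu) * enorm v <= enorm (v *m (1%:M + tau *: A)).
Proof.
move=> muA; have := loewner_geE v muA; rewrite mulmx_shift.
have := dot_le_enorm (v + tau *: (v *m A)) v.
rewrite !dotE -sqr_enorm; set y := dot (v *m A) v => hCS hy.
have [->|v0] := eqVneq (enorm v) 0; first by rewrite mulr0 enorm_ge0.
have vp : 0 < enorm v by rewrite lt_neqAle eq_sym v0 enorm_ge0.
rewrite -(ler_pM2r vp); apply: le_trans hCS.
have := ler_wpM2l tau_ge0 hy; lra.
Qed.

Lemma shift_unit A : loewner_le mu%:M A -> 1%:M + tau *: A \in unitmx.
Proof.
move=> muA; rewrite -row_free_unit -kermx_eq0; apply/eqP/row_matrixP => i.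
rewrite row0; apply: enorm_eq0; apply/eqP; rewrite eq_le enorm_ge0 andbT.
have := enorm_shift_ge (row i (kermx (1%:M + tau *: A))) muA.
by rewrite -row_mul mulmx_ker row0 enorm0 pmulr_rle0.
Qed.

Lemma mulmx_resolventK A v : loewner_le mu%:M A ->
  (v *m (1%:M + tau *: A)) *m resolvent A = v.
Proof. by move=> muA; rewrite mulmxK// shift_unit. Qed.

Lemma mulmx_shiftK A v : loewner_le mu%:M A ->
  (v *m resolvent A) *m (1%:M + tau *: A) = v.
Proof. by move=> muA; rewrite mulmxKV// shift_unit. Qed.

Lemma enorm_resolvent A v : loewner_le mu%:M A ->
  enorm (v *m resolvent A) <= enorm v / (1 + tau * mu).
Proof.
move=> muA; rewrite ler_pdivlMr// mulrC.
by have := enorm_shift_ge (v *m resolvent A) muA; rewrite mulmx_shiftK.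
Qed.

Lemma trmx_resolvent A : A^T = A -> (resolvent A)^T = resolvent A.
Proof. by move=> sA; rewrite trmx_inv linearD/= linearZ/= trmx1 sA. Qed.

End Resolvent.

(** * Linear algebra of a difference of envelope gradients *)

Section GradientDifference.
Context {R : realType} {n : nat}.
Variables (mu L tau gamma : R).
Hypotheses (mu_ge0 : 0 <= mu) (mu_le_L : mu <= L) (tau_ge0 : 0 <= tau).
Hypotheses (gamma_gt0 : 0 < gamma) (gammaL : gamma * L <= 1).
Implicit Types (u v w : 'rV[R]_n) (A B : 'M[R]_n).

Definition bounded_sym A :=
  [/\ A^T = A, loewner_le mu%:M A & loewner_le A L%:M].

(* The Cayley transform of [gamma *: A] when [tau = gamma], and [1 - gamma A]
   when [tau = 0]. *)
Definition cayley A : 'M[R]_n := (1%:M - gamma *: A) *m resolvent tau A.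

Let den_gt0 : 0 < 1 + tau * mu.
Proof. by rewrite ltr_wpDr// mulr_ge0. Qed.

Let gammamu : gamma * mu <= 1.
Proof. by apply: le_trans gammaL; rewrite ler_pM2l. Qed.

Lemma cayley_comm A : loewner_le mu%:M A ->
  cayley A = resolvent tau A *m (1%:M - gamma *: A).
Proof.
move=> muA; have uA := shift_unit mu_ge0 tau_ge0 muA.
apply: (can_inj (mulKmx uA)); rewrite /cayley !mulmxA mulmxV// mul1mx.
apply: (can_inj (mulmxK uA)); rewrite mulmxKV//.
rewrite !mulmxDl !mulmxDr !mul1mx !mulmx1 !mulNmx !mulmxN.
rewrite -!scalemxAl -!scalemxAr !scalerA (mulrC gamma).
by apply/matrixP => i j; rewrite !mxE; ring.
Qed.

(** The resolvent is put on the left for [A] and on the right for [B]. Between them remains [(1 -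
    gamma A) (1 + tau B) - (1 + tau A) (1 - gamma B)], where the products [A B] cancel although [A]
    and [B] need not commute. *)
Lemma cayleyB A B v : loewner_le mu%:M A -> loewner_le mu%:M B ->
  v *m cayley A - v *m cayley B =
  (gamma + tau) *: (v *m resolvent tau A *m (B - A) *m resolvent tau B).
Proof.
move=> muA muB; rewrite cayley_comm// [cayley B]/cayley !mulmxA.
rewrite -[X in X - _](mulmx_resolventK mu_ge0 tau_ge0 _ muB).
rewrite -[X in _ - X *m _ *m _](mulmx_shiftK mu_ge0 tau_ge0 _ muA).
set w := v *m resolvent tau A; rewrite -mulmxBl scalemxAl; congr (_ *m _).
rewrite -!scaleNr !mulmx_shift !mulmxDl -!scalemxAl mulmxBr.
by apply/rowP => i; rewrite !mxE; ring.
Qed.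

Lemma enorm_cayleyB A B v h : loewner_le mu%:M A -> loewner_le mu%:M B ->
  (forall w, enorm (w *m (B - A)) <= h * enorm w) -> 0 <= h ->
  enorm (v *m cayley A - v *m cayley B) <=
  (gamma + tau) * (h * enorm v) / (1 + tau * mu) ^+ 2.
Proof.
move=> muA muB hBA h0; have gt0 : 0 <= gamma + tau by rewrite addr_ge0// ltW.
rewrite cayleyB// enormZ ger0_norm//.
rewrite -mulrA ler_wpM2l//.
apply: (le_trans (enorm_resolvent mu_ge0 tau_ge0 _ muB)).
rewrite expr2 invfM mulrA ler_wpM2r ?invr_ge0 ?(ltW den_gt0)//.
apply: (le_trans (hBA _)); rewrite -mulrA ler_wpM2l//.
exact: enorm_resolvent.
Qed.

(** In the application [A] is the mean Hessian, [e = p x - p y], [u] is the difference of the two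
    proximal points of [g], and [d = x - y]. *)
Variables (A : 'M[R]_n) (e u : 'rV[R]_n).
Hypotheses (bA : bounded_sym A).
Hypothesis u_firm : dot u u <= dot u (e *m (1%:M - gamma *: A)).
Let d := e *m (1%:M + tau *: A).

Let sA : A^T = A. Proof. by case: bA. Qed.
Let muA : loewner_le mu%:M A. Proof. by case: bA. Qed.
Let AL : loewner_le A L%:M. Proof. by case: bA. Qed.

Let Q := 1%:M - gamma *: A.
Let QE v : v *m Q = v - gamma *: (v *m A).
Proof. by rewrite /Q -scaleNr mulmx_shift scaleNr. Qed.
Let sQ : Q^T = Q.
Proof. by rewrite /Q linearB/= linearZ/= trmx1 sA. Qed.

(** Passing from [e] to [e - u] does not increase the quadratic form of [Q]: the cross term
    contributes at most [-2 |u|^2] by firmness and the form at [u] at most [|u|^2]. Then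
    [Q ^ 2 <= (1 - gamma mu) Q] and [Q <= 1 - gamma mu] each give one factor of the squared
    bound. *)
Lemma enorm_firm_shift : enorm ((e - u) *m Q) <= (1 - gamma * mu) * enorm e.
Proof.
have q0 : 0 <= 1 - gamma * mu by rewrite subr_ge0.
rewrite enorm_leP ?mulr_ge0 ?enorm_ge0// exprMn sqr_enorm.
have QQ v : dot (v *m Q) (v *m Q) <= (1 - gamma * mu) * dot (v *m Q) v.
  (* The coefficients expand [(1 - gamma t) (gamma t - gamma mu)], which is zero at [t = mu] and
     nonnegative at [t = L] because [gamma * L <= 1]. *)
  have := concave_quadratic_ge0 (c0 := - (gamma * mu)) (c1 := gamma * (1 + gamma * mu))
    (k := gamma ^+ 2) v mu_le_L sA muA AL.
  rewrite QE !dotE (dotC v (v *m A)) sqr_ge0 => /(_ isT).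
  have -> : 0 <= - (gamma * mu) + gamma * (1 + gamma * mu) * mu - gamma ^+ 2 * mu ^+ 2.
    lra.
  have -> : 0 <= - (gamma * mu) + gamma * (1 + gamma * mu) * L - gamma ^+ 2 * L ^+ 2.
    have -> : - (gamma * mu) + gamma * (1 + gamma * mu) * L - gamma ^+ 2 * L ^+ 2
      = gamma * (L - mu) * (1 - gamma * L) by ring.
    by rewrite !mulr_ge0 ?subr_ge0// ltW.
  move=> /(_ isT isT).
  move: (dot v v) (dot (v *m A) v) (dot (v *m A) (v *m A)) => X Y Z H; nra.
apply: (le_trans (QQ _)); rewrite expr2 -mulrA ler_wpM2l//.
have Qle v : dot (v *m Q) v <= (1 - gamma * mu) * dot v v.
  by have := ler_wpM2l (ltW gamma_gt0) (loewner_geE v muA); rewrite QE !dotE; lra.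
apply: le_trans (Qle e); rewrite mulmxBl !dotE (dot_sym u e sQ) (dotC (e *m Q) u).
have := Qle u; have := dot_ge0 u; move: u_firm; rewrite -/Q.
have : 0 <= gamma * mu by rewrite mulr_ge0// ltW.
set a := dot u u => ? ? ?; have : 0 <= gamma * mu * a by rewrite mulr_ge0.
lra.
Qed.

Lemma enorm_le_enorm_shift : enorm e <= enorm d / (1 + tau * mu).
Proof. by rewrite ler_pdivlMr// mulrC; exact: enorm_shift_ge. Qed.

Lemma enorm_firm_cayley : enorm ((e - u) *m cayley A) <=
  (1 - gamma * mu) / (1 + tau * mu) ^+ 2 * enorm d.
Proof.
rewrite /cayley mulmxA (le_trans (enorm_resolvent mu_ge0 tau_ge0 _ muA))//.
rewrite expr2 invfM mulrA mulrAC ler_wpM2r ?invr_ge0 ?(ltW den_gt0)//.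
apply: (le_trans enorm_firm_shift); rewrite -mulrA ler_wpM2l ?subr_ge0//.
by rewrite mulrC enorm_le_enorm_shift.
Qed.

(** The factor [1 + tau A] in [d] cancels the resolvent, which leaves the pairing of [e - u] with
    [e *m Q]. Firmness gives [|u| <= |e Q|], so the worst case is [u = e Q], and what remains is the
    form of [gamma A (1 - gamma A)] at [e]. *)
Lemma dot_firm_cayley_ge m : 0 <= m ->
  m * (1 + tau * mu) ^+ 2 <= mu * (1 - gamma * mu) ->
  m * (1 + tau * L) ^+ 2 <= L * (1 - gamma * L) ->
  gamma * m * enorm d ^+ 2 <= dot ((e - u) *m cayley A) d.
Proof.
move=> m0 hmu hL.
rewrite /cayley mulmxA (dot_sym _ _ (trmx_resolvent tau sA)) /d.
rewrite (mulmx_resolventK mu_ge0 tau_ge0 _ muA) dot_sym// dotBl -/Q.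
have uQ : dot u (e *m Q) <= dot (e *m Q) (e *m Q).
  have hu : enorm u <= enorm (e *m Q).
    have [->|u0] := eqVneq (enorm u) 0; first exact: enorm_ge0.
    have up : 0 < enorm u by rewrite lt_neqAle eq_sym u0 enorm_ge0.
    rewrite -(ler_pM2l up) -expr2 sqr_enorm (le_trans u_firm)//.
    exact: dot_le_enorm.
  by rewrite (le_trans (dot_le_enorm _ _))// -sqr_enorm expr2 ler_wpM2r ?enorm_ge0.
apply: le_trans (_ : dot e (e *m Q) - dot (e *m Q) (e *m Q) <= _); last by lra.
(* The polynomial is [t (1 - gamma t) - m (1 + tau t) ^ 2], concave since [m >= 0]; the two
   hypotheses on [m] are its signs at [mu] and [L]. *)
have := concave_quadratic_ge0 (c0 := - m) (c1 := 1 - 2 * tau * m)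
    (k := gamma + m * tau ^+ 2) e mu_le_L sA muA AL.
rewrite sqr_enorm mulmx_shift QE !dotE (dotC e (e *m A)).
have -> : 0 <= gamma + m * tau ^+ 2 by rewrite addr_ge0 ?mulr_ge0 ?sqr_ge0// ltW.
have -> : 0 <= - m + (1 - 2 * tau * m) * mu - (gamma + m * tau ^+ 2) * mu ^+ 2.
  lra.
have -> : 0 <= - m + (1 - 2 * tau * m) * L - (gamma + m * tau ^+ 2) * L ^+ 2.
  lra.
move=> /(_ isT isT isT) /(mulr_ge0 (ltW gamma_gt0)); lra.
Qed.

(** Here [B] and [C] are the Hessians at [p x] and [p y], [a] and [b] the residuals there, and
    [h = H |e| / 2]. Only the product of [h] with a residual is bounded, so that [h = 0] admits
    arbitrary residuals. *)
Variables (B C : 'M[R]_n) (a b : 'rV[R]_n) (h K : R).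
Hypotheses (muB : loewner_le mu%:M B) (muC : loewner_le mu%:M C).
Hypotheses (hB : forall w, enorm (w *m (A - B)) <= h * enorm w)
           (hC : forall w, enorm (w *m (A - C)) <= h * enorm w) (h_ge0 : 0 <= h).
Hypothesis ab : a - b = e - u.
Hypotheses (ha : h * enorm a <= gamma * K * enorm e / 2)
           (hb : h * enorm b <= gamma * K * enorm e / 2).
Let gap := gamma^-1 *: (a *m cayley B) - gamma^-1 *: (b *m cayley C).

Lemma gradient_gapE : gap = gamma^-1 *: ((e - u) *m cayley A)
  + gamma^-1 *: ((a *m cayley B - a *m cayley A) - (b *m cayley C - b *m cayley A)).
Proof.
rewrite -ab mulmxBl -scalerDr /gap -scalerBr; congr (_ *: _).
by apply/rowP => i; rewrite !mxE; ring.
Qed.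

Lemma gradient_gap_error :
  enorm (gamma^-1 *: ((a *m cayley B - a *m cayley A) - (b *m cayley C - b *m cayley A)))
  <= (gamma + tau) * K / (1 + tau * mu) ^+ 3 * enorm d.
Proof.
have gt0 : 0 <= gamma + tau by rewrite addr_ge0// ltW.
rewrite enormZ gtr0_norm ?invr_gt0// ler_pdivrMl//.
apply: (le_trans (enormB _ _)).
apply: (le_trans (lerD (enorm_cayleyB a muB muA hB h_ge0)
  (enorm_cayleyB b muC muA hC h_ge0))).
have i2 : 0 <= ((1 + tau * mu) ^+ 2)^-1 by rewrite invr_ge0 exprn_ge0// ltW.
rewrite -mulrDl -mulrDr.
apply: le_trans (_ : (gamma + tau) * (gamma * K * enorm e) / (1 + tau * mu) ^+ 2 <= _).
  rewrite ler_wpM2r// ler_wpM2l//; by have := lerD ha hb; rewrite -splitr.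
have gKe : 0 <= gamma * K * enorm e.
  have := le_trans (mulr_ge0 h_ge0 (enorm_ge0 a)) ha.
  by rewrite pmulr_lge0.
(* No sign is assumed for [K]. For [e = 0] both sides vanish; otherwise [gKe] forces [K >= 0], which
   allows [|e|] to be replaced by its bound in [|d|]. *)
have [e0|e0] := eqVneq (enorm e) 0.
  have d0 : enorm d = 0 by rewrite /d (enorm_eq0 e0) mul0mx enorm0.
  by rewrite e0 d0 !(mulr0, mul0r).
have ep : 0 < enorm e by rewrite lt_neqAle eq_sym e0 enorm_ge0.
have K0 : 0 <= K.
  by move: gKe; rewrite pmulr_lge0// pmulr_rge0.
have -> : gamma * ((gamma + tau) * K / (1 + tau * mu) ^+ 3 * enorm d) =
  (gamma + tau) * (gamma * K * (enorm d / (1 + tau * mu))) / (1 + tau * mu) ^+ 2.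
  by field; rewrite gt_eqF.
rewrite ler_wpM2r// ler_wpM2l// ler_wpM2l ?enorm_le_enorm_shift//.
by rewrite mulr_ge0// ltW.
Qed.

Lemma gradient_gap_le : enorm gap <=
  ((1 - gamma * mu) / (gamma * (1 + tau * mu) ^+ 2)
   + (gamma + tau) * K / (1 + tau * mu) ^+ 3) * enorm d.
Proof.
rewrite gradient_gapE (le_trans (enormD _ _))// mulrDl lerD ?gradient_gap_error//.
rewrite enormZ gtr0_norm ?invr_gt0// ler_pdivrMl//.
apply: le_trans enorm_firm_cayley _; rewrite le_eqVlt; apply/orP; left; apply/eqP.
by field; rewrite !gt_eqF.
Qed.

Lemma gradient_gap_ge m : 0 <= m ->
  m * (1 + tau * mu) ^+ 2 <= mu * (1 - gamma * mu) ->
  m * (1 + tau * L) ^+ 2 <= L * (1 - gamma * L) ->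
  (m - (gamma + tau) * K / (1 + tau * mu) ^+ 3) * enorm d ^+ 2 <= dot gap d.
Proof.
move=> m0 hmu hL; have := dot_firm_cayley_ge m0 hmu hL.
rewrite gradient_gapE dotDl dotZl.
move: gradient_gap_error; set r := _ *: (_ - _) => hr.
have hr' : - dot r d <= (gamma + tau) * K / (1 + tau * mu) ^+ 3 * enorm d ^+ 2.
  rewrite -dotNl (le_trans (dot_le_enorm _ _))// enormN expr2 mulrA.
  by rewrite ler_wpM2r ?enorm_ge0.
rewrite -mulrA -(ler_pM2l (_ : 0 < gamma^-1)) ?invr_gt0// mulKf ?gt_eqF//.
lra.
Qed.

End GradientDifference.

(** * Gradients and Jacobians through first-order expansions in the Euclidean norm *)

Section Differentials.
Context {R : realType}.

Lemma is_diff_of_approx (V W : normedModType R) (F : V -> W)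
    (dF : {linear V -> W}) (x : V) : continuous dF ->
  (forall e, 0 < e ->
    \forall h \near (0 : V), `|F (h + x) - (F x + dF h)| <= e * `|h|) ->
  is_diff x F dF.
Proof.
move=> cdF happ.
have hF : F \o shift x = cst (F x) + dF +o_ 0 id by apply/eqaddoP.
have dFE : 'd F x = dF :> (V -> W) by exact: diff_unique.
by apply: DiffDef => //; apply/diff_locallyP; rewrite dFE.
Qed.

Lemma differentiable_approx (V W : normedModType R) (F : V -> W) (x : V) e :
  differentiable F x -> 0 < e ->
  \forall h \near (0 : V), `|F (h + x) - (F x + 'd F x h)| <= e * `|h|.
Proof. by move=> /diff_locally /eqaddoP; apply. Qed.

Context {n : nat}.
Implicit Types (x y v w d : 'rV[R]_n).

Lemma nbhs0_enormP (P : 'rV[R]_n -> Prop) :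
  (\forall h \near (0 : 'rV[R]_n), P h) <->
  exists2 e : R, 0 < e & forall h, enorm h < e -> P h.
Proof.
split=> [/nbhs_ballP[e /= e0 he]|[e e0 he]].
  exists e => // h hh; apply: he; rewrite -ball_normE/= sub0r normrN.
  exact: le_lt_trans (mx_norm_le_enorm _) hh.
apply/nbhs_ballP; exists (e / n.+1%:R) => /=; first by rewrite divr_gt0.
move=> h; rewrite -ball_normE/= sub0r normrN ltr_pdivlMr// mulrC => hh.
by apply: he; exact: le_lt_trans (enorm_le_mx_norm _) hh.
Qed.

Lemma linear_continuous_of_bound (V W : normedModType R) (F : {linear V -> W})
  (C : R) : (forall v : V, `|F v| <= C * `|v|) -> continuous F.
Proof.
move=> hC; apply: bounded_linear_continuous; apply/linear_boundedP.
exists C; split; first exact: num_real.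
by move=> r Cr v; rewrite (le_trans (hC v))// ler_wpM2r// ltW.
Qed.

Lemma dot_is_linear (g : 'rV[R]_n) : linear (dot g : 'rV[R]_n -> R^o).
Proof. by move=> a u v; rewrite !dotE. Qed.

HB.instance Definition _ (g : 'rV[R]_n) :=
  GRing.isLinear.Build R 'rV[R]_n R^o _ (dot g) (dot_is_linear g).

Lemma dot_continuous g : continuous (dot g : 'rV[R]_n -> R^o).
Proof.
apply: (@linear_continuous_of_bound _ _ _ (enorm g * n.+1%:R)) => v.
rewrite (le_trans (cauchy_schwarz _ _))// -mulrA ler_wpM2l ?enorm_ge0//.
exact: enorm_le_mx_norm.
Qed.

Lemma diff_gradE (F : 'rV[R]_n -> R) x v : differentiable F x ->
  'd F x v = dot (grad F x) v.
Proof.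
move=> dF; rewrite [in LHS](row_sum_delta v) linear_sum/= /dot.
by apply: eq_bigr => i _; rewrite linearZ/= !mxE deriveE// mulrC.
Qed.

Lemma grad_of_approx (F : 'rV[R]_n -> R) x g :
  (forall e, 0 < e -> \forall h \near (0 : 'rV[R]_n),
     `|F (h + x) - (F x + dot g h)| <= e * enorm h) ->
  differentiable F x /\ grad F x = g.
Proof.
move=> happ.
have [dF dFE] : is_diff x (F : 'rV[R]_n -> R^o) (dot g).
  apply: is_diff_of_approx; first exact: dot_continuous.
  move=> e e0; have e'0 : 0 < e / n.+1%:R by rewrite divr_gt0.
  apply: filterS (happ _ e'0) => h /le_trans; apply.
  by rewrite mulrAC ler_pdivrMr// -mulrA ler_wpM2l ?(ltW e0)// mulrC enorm_le_mx_norm.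
split => //; apply: dot_inj => w.
by rewrite -diff_gradE// [in LHS]dFE.
Qed.

Lemma grad_approx (F : 'rV[R]_n -> R) x e : differentiable F x -> 0 < e ->
  \forall h \near (0 : 'rV[R]_n),
    `|F (h + x) - (F x + dot (grad F x) h)| <= e * enorm h.
Proof.
move=> dF e0; apply: filterS (differentiable_approx dF e0) => h.
rewrite diff_gradE// => /le_trans; apply.
by rewrite ler_wpM2l ?(ltW e0)// mx_norm_le_enorm.
Qed.

Lemma diff_jacobianE m (F : 'rV[R]_n -> 'rV[R]_m) x v : 'd F x v = v *m 'J F x.
Proof. by rewrite /jacobian mul_rV_lin1. Qed.

Lemma jacobian_approx m (F : 'rV[R]_n -> 'rV[R]_m) x e :
  differentiable F x -> 0 < e ->
  \forall h \near (0 : 'rV[R]_n),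
    enorm (F (h + x) - (F x + h *m 'J F x)) <= e * enorm h.
Proof.
move=> dF e0; have e'0 : 0 < e / m.+1%:R by rewrite divr_gt0.
apply: filterS (differentiable_approx dF e'0) => h.
rewrite diff_jacobianE => hh.
rewrite (le_trans (enorm_le_mx_norm _))// mulrC -ler_pdivlMr//.
rewrite (le_trans hh)// -mulrAC ler_wpM2r ?invr_ge0// ler_wpM2l ?(ltW e0)//.
exact: mx_norm_le_enorm.
Qed.

Lemma jacobian_of_approx m (F : 'rV[R]_n -> 'rV[R]_m) x A :
  (forall e, 0 < e -> \forall h \near (0 : 'rV[R]_n),
     enorm (F (h + x) - (F x + h *m A)) <= e * enorm h) ->
  differentiable F x /\ 'J F x = A.
Proof.
move=> happ.
have cA : continuous (mulmxr A : 'rV[R]_n -> 'rV[R]_m).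
  have @f : {linear 'rV[R]_n -> 'rV[R]_m} := mulmxr A.
  suff : continuous (f : 'rV[R]_n -> 'rV[R]_m) by [].
  apply: (@linear_continuous_of_bound _ _ f (\sum_i \sum_j `|A i j|)) => v.
  rewrite [leLHS]/Num.norm/= mx_normrE; apply/bigmax_leP; split.
    by rewrite mulr_ge0// !sumr_ge0// => i _; rewrite sumr_ge0.
  case=> i j _/=; rewrite (ord1 i) mxE (le_trans (ler_norm_sum _ _ _))//.
  rewrite mulr_suml ler_sum// => k _; rewrite normrM mulrC ler_pM//.
    by rewrite (bigD1 j)//= lerDl sumr_ge0.
  exact: coord_le_mx_norm.
have [dF dFE] : is_diff x F (mulmxr A).
  apply: is_diff_of_approx; first exact: cA.
  move=> e e0; have e'0 : 0 < e / n.+1%:R by rewrite divr_gt0.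
  apply: filterS (happ _ e'0) => h hh.
  rewrite (le_trans (mx_norm_le_enorm _))// (le_trans hh)//.
  by rewrite mulrAC ler_pdivrMr// -mulrA ler_wpM2l ?(ltW e0)// mulrC enorm_le_mx_norm.
split => //; apply/row_matrixP => i.
by rewrite !rowE -diff_jacobianE [in LHS]dFE.
Qed.

Lemma grad_comp (F : 'rV[R]_n -> R) (phi : 'rV[R]_n -> 'rV[R]_n) x :
  differentiable phi x -> differentiable F (phi x) ->
  differentiable (F \o phi) x /\
  grad (F \o phi) x = grad F (phi x) *m ('J phi x)^T.
Proof.
move=> dphi dF; have dFphi := differentiable_comp dphi dF.
split => //; apply: dot_inj => w.
by rewrite -diff_gradE// diff_comp//= diff_gradE// diff_jacobianE dot_mulmxl trmxK.
Qed.

Lemma is_derive_line (F : 'rV[R]_n -> R) x d (t : R) :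
  differentiable F (x + t *: d) ->
  is_derive t 1 (fun s : R => F (x + s *: d)) (dot (grad F (x + t *: d)) d).
Proof.
move=> dF.
have [dl dlE] : is_diff t (fun s : R => x + s *: d) (fun s : R => s *: d).
  apply: is_diff_eq; rewrite funeqE => s/=.
  by rewrite -[LHS]/(0 + s *: d) add0r.
have dFl : differentiable (F \o (fun s : R => x + s *: d)) t.
  exact: differentiable_comp.
apply: DeriveDef; first exact: diff_derivable.
by rewrite deriveE// diff_comp//= dlE scale1r diff_gradE.
Qed.

Lemma segment_MVT (F : 'rV[R]_n -> R) x y :
  (forall t : R, 0 <= t <= 1 -> differentiable F (x + t *: (y - x))) ->
  exists2 t, 0 < t < 1 & F y - F x = dot (grad F (x + t *: (y - x))) (y - x).
Proof.
move=> dF; pose phi t := F (x + t *: (y - x)).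
pose dphi t := dot (grad F (x + t *: (y - x))) (y - x).
have h (t : R) : 0 <= t <= 1 -> is_derive t 1 phi (dphi t).
    by move=> t01; apply: is_derive_line; exact: dF.
have [t t01] : exists2 t, t \in `]0, 1[%R & phi 1 - phi 0 = dphi t * (1 - 0).
  apply: MVT => //.
    by move=> t; rewrite in_itv/= => /andP[t0 t1]; apply: h; rewrite !ltW.
  apply: derivable_within_continuous => t; rewrite in_itv/= => t01.
  by have [] := h t t01.
rewrite /phi scale1r scale0r addr0 subrKC subr0 mulr1 => ->.
by exists t.
Qed.

End Differentials.

(** * Symmetry of the Hessian *)

Section HessianSymmetry.
Context {R : realType} {n : nat}.
Implicit Types (x u v w : 'rV[R]_n).

(* Comparing the two orders of increments yields the symmetry of the Hessian
   at a point where the gradient is merely differentiable. *)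
Lemma second_difference_approx (F : 'rV[R]_n -> R) x e :
  (forall z, differentiable F z) -> differentiable (grad F) x -> 0 < e ->
  exists2 r : R, 0 < r & forall u v, enorm u + enorm v < r ->
    `|F (x + v + u) - F (x + u) - (F (x + v) - F x)
      - dot (v *m hessian F x) u| <= e * (enorm u + enorm v) ^+ 2.
Proof.
move=> dF dG e0; have e20 : 0 < e / 2 by rewrite divr_gt0.
have /nbhs0_enormP[r r0 hr] := jacobian_approx dG e20.
exists r => // u v uvr.
(* The mean value theorem along [u] turns the second difference into a difference of two gradients;
   both are then expanded at [x], with increments [v + t u] and [t u], so differentiability of the
   gradient at [x] alone suffices. *)
pose phi (t : R) := F (x + v + t *: u) - F (x + t *: u).
pose dphi (t : R) := dot (grad F (x + v + t *: u) - grad F (x + t *: u)) u.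
have h (t : R) : is_derive t 1 phi (dphi t).
  have h1 := @is_derive_line R n F (x + v) u t (dF _).
  have h2 := @is_derive_line R n F x u t (dF _).
  by apply: is_derive_eq; rewrite /dphi dotBl.
have [t /[!in_itv]/=/andP[t0 t1]] :
    exists2 t, t \in `]0, 1[%R & phi 1 - phi 0 = dphi t * (1 - 0).
  apply: MVT => //; apply: derivable_within_continuous => t _.
  by have [] := h t.
rewrite subr0 mulr1 /phi !scale1r !scale0r !addr0 => ->.
rewrite /dphi -dotBl (le_trans (cauchy_schwarz _ _))//.
set A := hessian F x; have tu : enorm (t *: u) <= enorm u.
  by rewrite enormZ gtr0_norm// ler_piMl ?enorm_ge0// ltW.
have vtu := enormD v (t *: u).
have eu := enorm_ge0 u; have ev := enorm_ge0 v.
have h1 : enorm (v + t *: u) < r by lra.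
have h2 : enorm (t *: u) < r by lra.
have {h1} := hr _ h1; have {h2} := hr _ h2.
rewrite -!/(hessian F x) -/A.
rewrite [v + _ + x]addrC addrA [t *: u + x]addrC mulmxDl.
set g1 := grad F (x + v + _); set g2 := grad F (x + _); set g0 := grad F x.
set w := t *: u *m A => h2 h1.
have -> : g1 - g2 - v *m A = (g1 - (g0 + (v *m A + w))) - (g2 - (g0 + w)).
  by apply/rowP => i; rewrite !mxE; ring.
have hB := enormB (g1 - (g0 + (v *m A + w))) (g2 - (g0 + w)).
have h12 : e / 2 * enorm (v + t *: u) + e / 2 * enorm (t *: u) <=
    e * (enorm u + enorm v).
  rewrite -mulrDr -mulrA ler_wpM2l ?(ltW e0)//; lra.
rewrite expr2 mulrA ler_pM ?enorm_ge0//; lra.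
Qed.

Lemma hessian_sym (F : 'rV[R]_n -> R) x :
  (forall z, differentiable F z) -> differentiable (grad F) x ->
  (hessian F x)^T = hessian F x.
Proof.
move=> dF dG; set A := hessian F x.
(* Exchanging [u] and [v] turns this inequality into the equality. *)
suff h u v : dot (v *m A) u <= dot (u *m A) v.
  apply/trmx_inj; rewrite trmxK; apply/row_matrixP => i; rewrite !rowE.
  apply: dot_inj => w; rewrite -[RHS]dotC -dot_mulmxl.
  by apply/eqP; rewrite eq_le !h.
apply/ler_addgt0Pr => e e0.
set N := enorm u + enorm v.
have N0 : 0 <= N by rewrite addr_ge0 ?enorm_ge0.
(* For increments scaled by [s], each order deviates by at most [d (s N) ^ 2]. After division by
   [s ^ 2] the total is [2 d N ^ 2 <= e]; the [+ 1] covers [N = 0]. *)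
pose d := e / (2 * (N ^+ 2 + 1)).
have den0 : 0 < 2 * (N ^+ 2 + 1) by have := sqr_ge0 N; lra.
have d0 : 0 < d by rewrite divr_gt0.
have [r r0 hr] := second_difference_approx dF dG d0.
pose s := r / (2 * (N + 1)).
have s0 : 0 < s by rewrite divr_gt0//; lra.
have sN : enorm (s *: u) + enorm (s *: v) = s * N.
  by rewrite !enormZ gtr0_norm// mulrDr.
have sNr : s * N < r.
  rewrite /s mulrAC ltr_pdivrMr; last by lra.
  rewrite ltr_pM2l//; lra.
have h1 := hr (s *: u) (s *: v); have h2 := hr (s *: v) (s *: u).
rewrite sN in h1; rewrite addrC sN in h2.
have {}h1 := h1 sNr; have {}h2 := h2 sNr.
move: h1 h2; rewrite -/A -!scalemxAl !dotE [x + _ + s *: u]addrAC => h1 h2.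
have {h1}/ler_normlP[h1 _] := h1.
have {h2}/ler_normlP[_ h2] := h2.
have s2 : 0 < s * s by rewrite mulr_gt0.
rewrite -(ler_pM2l s2).
have hd : 2 * d * N ^+ 2 <= e.
  rewrite /d; have -> : 2 * (e / (2 * (N ^+ 2 + 1))) * N ^+ 2 = e * N ^+ 2 / (N ^+ 2 + 1).
    by field; rewrite gt_eqF//; lra.
  rewrite ler_pdivrMr; last by lra.
  by rewrite ler_wpM2l ?(ltW e0)//; lra.
have := ler_wpM2l (ltW s2) hd; lra.
Qed.

End HessianSymmetry.

(** * The mean of a matrix-valued function along a segment *)

Section MeanMatrix.
Context {R : realType} {n : nat}.

Lemma primitive (psi : R -> R) : continuous psi ->
  exists Psi : R -> R, forall t : R, 0 <= t <= 1 -> is_derive t 1 Psi (psi t).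
Proof.
(* Integrating from [-1], inside [[-1, 2]], makes 0 and 1 interior points, so the derivative there
   is two-sided. *)
move=> cpsi; exists (fun t => (\int[lebesgue_measure]_(s in [set` `[-1, t]]) psi s)%R).
move=> t /andP[t0 t1].
have ipsi : lebesgue_measure.-integrable `[-1, 2] (EFin \o psi).
  apply: continuous_compact_integrable; first exact: segment_compact.
  exact: continuous_subspaceT.
have [] := @continuous_FTC1_closed R psi (-1) t 2 _ ipsi _ (cpsi t); [lra|lra|].
by move=> dPsi <-; rewrite derive1E; apply: DeriveDef.
Qed.

Lemma deriv_le0_le (D dD : R -> R) :
  (forall t : R, 0 <= t <= 1 -> is_derive t 1 D (dD t)) ->
  (forall t : R, 0 < t < 1 -> dD t <= 0) -> D 1 <= D 0.
Proof.
move=> h hle.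
have [t t01] : exists2 t : R, t \in `]0, 1[%R & D 1 - D 0 = dD t * (1 - 0).
  apply: MVT => //.
    by move=> t; rewrite in_itv/= => /andP[t0 t1]; apply: h; rewrite !ltW.
  apply: derivable_within_continuous => t; rewrite in_itv/= => t01.
  by have [] := h t t01.
rewrite subr0 mulr1 => e; rewrite -subr_le0 e hle//.
Qed.

(* [M] plays the role of the entrywise integral of [J] over [0, 1]; testing it
   against primitives [chi] avoids computing with integrals. *)
Lemma mean_matrix (J : R -> 'M[R]_n) :
  (forall i j, continuous (fun t : R => J t i j)) ->
  exists M : 'M[R]_n, forall w v (chi dchi : R -> R),
    (forall t : R, 0 <= t <= 1 -> is_derive t 1 chi (dchi t)) ->
    (forall t : R, 0 < t < 1 -> dot (w *m J t) v <= dchi t) ->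
    dot (w *m M) v <= chi 1 - chi 0.
Proof.
move=> cJ.
have /choice[Psi hPsi] : forall ij : 'I_n * 'I_n, exists Psi : R -> R,
    forall t : R, 0 <= t <= 1 -> is_derive t 1 Psi (J t ij.1 ij.2).
  by move=> ij; exact: primitive.
exists (\matrix_(i, j) (Psi (i, j) 1 - Psi (i, j) 0)) => w v chi dchi hchi hle.
pose P (t : R) : 'M[R]_n := \matrix_(i, j) Psi (i, j) t.
have dotP (A : 'M[R]_n) : dot (w *m A) v = \sum_i \sum_j v 0 i * (w 0 j * A j i).
  by apply: eq_bigr => i _; rewrite mxE mulr_suml; apply: eq_bigr => j _; rewrite mulrC.
have hP (t : R) : 0 <= t <= 1 ->
    is_derive t 1 (fun s : R => dot (w *m P s) v) (dot (w *m J t) v).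
  move=> t01; rewrite dotP.
  have -> : (fun s : R => dot (w *m P s) v) =
    \sum_i \sum_j (v 0 i * w 0 j) *: Psi (j, i).
    rewrite funeqE => s; rewrite dotP fct_sumE; apply: eq_bigr => i _.
    rewrite fct_sumE; apply: eq_bigr => j _; rewrite mxE mulrA//.
  have h i j := hPsi (j, i) t t01.
  apply: is_derive_eq; apply: eq_bigr => i _; apply: eq_bigr => j _.
  by rewrite mulrA.
(* The difference of the two primitives has nonpositive derivative, so it does not increase from 0
   to 1. *)
have : dot (w *m P 1) v - chi 1 <= dot (w *m P 0) v - chi 0.
  apply: (@deriv_le0_le (fun s : R => dot (w *m P s) v - chi s)
                        (fun t : R => dot (w *m J t) v - dchi t)) => t t01.
    by have h1 := hP t t01; have h2 := hchi t t01; exact: is_deriveB.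
  by rewrite subr_le0 hle.
have -> : \matrix_(i, j) (Psi (i, j) 1 - Psi (i, j) 0) = P 1 - P 0.
  by apply/matrixP => i j; rewrite !mxE.
rewrite mulmxBr dotBl; lra.
Qed.

End MeanMatrix.

Section MeanHessian.
Context {R : realType} {n : nat}.

Lemma is_derive_dot_line (g : 'rV[R]_n -> 'rV[R]_n) y d w (t : R) :
  differentiable g (y + t *: d) ->
  is_derive t 1 (fun s : R => dot (g (y + s *: d)) w)
    (dot (d *m 'J g (y + t *: d)) w).
Proof.
move=> dg; set z := y + t *: d.
have dw : is_diff (g z) (dot w : 'rV[R]_n -> R^o) (dot w).
  by apply: DiffDef; [apply: linear_differentiable|apply: diff_lin];
     exact: dot_continuous.
have dF : differentiable (dot w \o g : 'rV[R]_n -> R^o) z.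
  exact: differentiable_comp.
have := @is_derive_line R n _ y d t dF.
rewrite -diff_gradE// diff_comp//= diff_val/= diff_jacobianE -/z dotC.
by under [X in is_derive _ _ X]eq_fun do rewrite dotC.
Qed.

Lemma continuous_of_lipschitz (psi : R -> R) (C : R) : 0 <= C ->
  (forall s t, `|psi s - psi t| <= C * `|s - t|) -> continuous psi.
Proof.
move=> C0 hpsi s; apply/cvgrPdist_lt => e e0; apply/nbhs_ballP.
have C1 : 0 < C + 1 by lra.
exists (e / (C + 1)) => /=; first by rewrite divr_gt0.
move=> t; rewrite /ball/= ltr_pdivlMr// => st.
apply: le_lt_trans (hpsi s t) _; apply: le_lt_trans st.
by rewrite mulrC ler_wpM2l//; lra.
Qed.

(** The Hessian is controlled only for parameters in [[0, 1]], whereas [mean_matrix] asks for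
    continuity on the whole line. Composing with this 1-Lipschitz projection provides it without
    changing values on [[0, 1]]. *)
Let clamp (t : R) : R := Order.max 0 (Order.min 1 t).

Let clamp01 t : 0 <= clamp t <= 1.
Proof. by rewrite /clamp le_max lexx ge_max ler01 ge_min lexx. Qed.

Let clampE (t : R) : 0 <= t <= 1 -> clamp t = t.
Proof. by move=> /andP[t0 t1]; rewrite /clamp min_r// max_r. Qed.

Let clamp_lip s t : `|clamp s - clamp t| <= `|s - t|.
Proof.
have clampP r : [\/ r <= 0 /\ clamp r = 0, 0 <= r <= 1 /\ clamp r = r
    | 1 <= r /\ clamp r = 1].
  case: (leP r 0) => r0.
    by apply: Or31; split=> //; rewrite /clamp min_r ?max_l// (le_trans r0).
  case: (leP r 1) => r1; first by apply: Or32; rewrite clampE (ltW r0).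
  by apply: Or33; rewrite /clamp min_l ?max_r// ltW.
case: (clampP s) => -[hs ->]; case: (clampP t) => -[ht ->];
  have := ler_norm (s - t); have := ler_norm (t - s); rewrite distrC ler_norml;
  move=> ? ?; apply/andP; split; lra.

Qed.

Variables (g : 'rV[R]_n -> 'rV[R]_n) (J : 'rV[R]_n -> 'M[R]_n)
  (x y : 'rV[R]_n) (mu L H : R).
Let z (t : R) := y + t *: (x - y).
Hypotheses (H_ge0 : 0 <= H) (dg : forall v, differentiable g v)
  (JE : forall v, 'J g v = J v)
  (bJ : forall t : R, 0 <= t <= 1 -> bounded_sym mu L (J (z t)))
  (lipJ : forall (s t : R) w, 0 <= s <= 1 -> 0 <= t <= 1 ->
     enorm (w *m (J (z s) - J (z t))) <= H * enorm (z s - z t) * enorm w).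

Let enorm_zB s t : enorm (z s - z t) = `|s - t| * enorm (x - y).
Proof.
by rewrite /z opprD addrACA subrr add0r -scalerBl enormZ.
Qed.

(** The factor one half appears because the deviation from the Hessian at [x], resp. [y], is bounded
    by [1 - t], resp. [t], times [H |x - y|], and both weights have mean 1/2 over [[0, 1]]. *)
Lemma mean_jacobian : exists M : 'M[R]_n,
  [/\ bounded_sym mu L M, (x - y) *m M = g x - g y,
      forall w, enorm (w *m (M - J x)) <= H * enorm (x - y) / 2 * enorm w
    & forall w, enorm (w *m (M - J y)) <= H * enorm (x - y) / 2 * enorm w].
Proof.
pose Jc t := J (z (clamp t)).
have [i j|M0 hM0] := @mean_matrix R n Jc.
  apply: (@continuous_of_lipschitz _ (H * enorm (x - y))) => [|s t].
    by rewrite mulr_ge0 ?enorm_ge0.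
  have -> : Jc s i j - Jc t i j =
      dot (delta_mx 0 i *m (Jc s - Jc t)) (delta_mx 0 j).
    by rewrite dot_delta -rowE !mxE.
  rewrite (le_trans (cauchy_schwarz _ _))//.
  have e1 k : enorm (delta_mx 0 k : 'rV[R]_n) = 1.
    by rewrite /enorm dot_delta mxE !eqxx sqrtr1.
  rewrite e1 mulr1 (le_trans (lipJ _ (clamp01 s) (clamp01 t)))// e1 mulr1.
  rewrite enorm_zB mulrCA mulrC ler_wpM2l ?mulr_ge0 ?enorm_ge0//.
(* Symmetrizing is harmless since each [J] is symmetric. *)
pose M := 2^-1 *: (M0 + M0^T).
have hM w v (chi dchi : R -> R) :
    (forall t : R, 0 <= t <= 1 -> is_derive t 1 chi (dchi t)) ->
    (forall t : R, 0 < t < 1 -> dot (w *m J (z t)) v <= dchi t) ->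
    dot (w *m M) v <= chi 1 - chi 0.
  move=> h1 h2.
  have h3 := hM0 w v _ _ h1; have h4 := hM0 v w _ _ h1.
  rewrite /M -scalemxAr mulmxDr dotZl dotDl (dot_mulmxl M0^T) trmxK (dotC w).
  suff : dot (w *m M0) v <= chi 1 - chi 0 /\ dot (v *m M0) w <= chi 1 - chi 0.
    by case; lra.
  have tE (t : R) : 0 < t < 1 -> 0 <= t <= 1 by case/andP=> t0 t1; rewrite !ltW.
  split; [apply: h3|apply: h4] => t t01; rewrite /Jc clampE ?(tE _ t01)//; first exact: h2.
  by have [sJ _ _] := bJ (tE _ t01); rewrite dot_sym// dotC h2.
(* Test primitives: [b = 0] transfers constant bounds to [M], and [b = C / 2] or [- (C / 2)] the
   deviations growing linearly from either end of the segment. *)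
have derQ (a b t : R) :
    is_derive t 1 (fun s : R => a * s + b * s * s) (a + 2 * b * t).
  have der1 (c : R) : is_derive t 1 (fun s : R => c * s) c.
    by apply: is_derive_eq (@is_deriveZ R R R id c t 1 1 _) _; rewrite /GRing.scale/= mulr1.
  have der2 := @is_deriveM R R _ _ t 1 _ _ (der1 b) (@is_derive_id R R t 1).
  apply: is_derive_eq (is_deriveD (der1 a) der2) _.
  by rewrite /GRing.scale/=; ring.
have hcst w v c : (forall t : R, 0 <= t <= 1 -> dot (w *m J (z t)) v <= c) ->
    dot (w *m M) v <= c.
  move=> hc; have := hM w v _ _ (fun t _ => derQ c 0 t).
  rewrite !(mulr0, mul0r, mulr1, addr0, subr0); apply => t /andP[t0 t1].
  by rewrite !(mulr0, mul0r, addr0) hc// !ltW.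
have z0 : z 0 = y by rewrite /z scale0r addr0.
have z1 : z 1 = x by rewrite /z scale1r subrKC.
have hdev w v (s t : R) : 0 <= s <= 1 -> 0 <= t <= 1 ->
    dot (w *m J (z s)) v <= dot (w *m J (z t)) v
      + H * enorm (x - y) * enorm w * enorm v * `|s - t|.
  move=> s01 t01; rewrite -lerBlDl -dotBl -mulmxBr.
  rewrite (le_trans (dot_le_enorm _ _))//.
  have := ler_wpM2r (enorm_ge0 v) (lipJ w s01 t01).
  by rewrite enorm_zB; lra.
exists M; split.
- split.
  + by rewrite /M linearZ/= linearD/= trmxK addrC.
  + move=> v; rewrite mulmxBr mul_mx_scalar !dotE subr_ge0.
    have := hcst (- v) v (- (mu * dot v v)); rewrite !mulNmx dotNl lerN2; apply.
    move=> t t01; rewrite mulNmx dotNl lerN2; apply: loewner_geE.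
    by have [] := bJ t01.
  + move=> v; rewrite mulmxBr mul_mx_scalar !dotE subr_ge0.
    by apply: hcst => t t01; apply: loewner_leE; have [] := bJ t01.
- have hg w (t : R) : 0 <= t <= 1 -> is_derive t 1 (fun s : R => dot (g (z s)) w)
     (dot ((x - y) *m J (z t)) w).
    by move=> _; rewrite -JE; apply: is_derive_dot_line; exact: dg.
  (* The primitive is [g] itself along the segment, paired with [w]; replacing [w] by [- w] makes
     the inequality an equality. *)
  have hgw w : dot ((x - y) *m M) w <= dot (g x - g y) w.
    have := hM (x - y) w _ _ (hg w) (fun t _ => lexx _).
    by rewrite z0 z1 dotBl.
  apply: dot_inj => w; apply/eqP; rewrite eq_le hgw/=.
  by have := hgw (- w); rewrite !dotNr lerN2.
- move=> w; apply: enorm_le_dual; first by rewrite !mulr_ge0 ?enorm_ge0.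
  move=> v; rewrite mulmxBr dotBl; set c := dot (w *m J x) v.
  pose C := H * enorm (x - y) * enorm w * enorm v.
  have := hM w v _ _ (fun t _ => derQ (c + C) (- (C / 2)) t).
  rewrite !(mulr0, mul0r, mulr1, addr0, subr0).
  suff h (t : R) : 0 < t < 1 -> dot (w *m J (z t)) v <= c + C + 2 * - (C / 2) * t.
    by move=> /(_ h); rewrite /C; lra.
  move=> /andP[t0 t1]; have t01 : 0 <= t <= 1 by rewrite (ltW t0) (ltW t1).
  have h1 : 0 <= (1 : R) <= 1 by rewrite ler01 lexx.
  have := hdev w v _ _ t01 h1.
  rewrite z1 -/c -/C distrC ger0_norm ?subr_ge0 ?(ltW t1)//; lra.
- move=> w; apply: enorm_le_dual; first by rewrite !mulr_ge0 ?enorm_ge0.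
  move=> v; rewrite mulmxBr dotBl; set c := dot (w *m J y) v.
  pose C := H * enorm (x - y) * enorm w * enorm v.
  have := hM w v _ _ (fun t _ => derQ c (C / 2) t).
  rewrite !(mulr0, mul0r, mulr1, addr0, subr0).
  suff h (t : R) : 0 < t < 1 -> dot (w *m J (z t)) v <= c + 2 * (C / 2) * t.
    by move=> /(_ h); rewrite /C; lra.
  move=> /andP[t0 t1]; have t01 : 0 <= t <= 1 by rewrite (ltW t0) (ltW t1).
  have h0 : 0 <= (0 : R) <= 1 by rewrite ler01 lexx.
  have := hdev w v _ _ t01 h0.
  rewrite z0 -/c -/C subr0 gtr0_norm//; lra.
Qed.

End MeanHessian.

(** * Proximal maps and Moreau envelopes *)

Section Prox.
Context {R : realType} {n : nat}.
Variables (h : 'rV[R]_n -> \bar R) (gamma : R).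
Hypotheses (h_proper : proper_efun h) (h_closed : closed_efun h)
  (h_convex : convex_efun h) (gamma_gt0 : 0 < gamma).
Implicit Types (x y z w p q : 'rV[R]_n) (a b : R).

Let c := (2 * gamma)^-1.
Let c_gt0 : 0 < c. Proof. by rewrite invr_gt0 mulr_gt0. Qed.
Let c_ge0 : 0 <= c := ltW c_gt0.

Lemma efun_fin_or_pinfty x : (exists a, h x = a%:E) \/ h x = +oo%E.
Proof.
have := h_proper.1 x; case: (h x) => [a||]//; first by left; exists a.
by right.
Qed.

Lemma efun_convexW x y a b t : (h x <= a%:E)%E -> (h y <= b%:E)%E ->
  0 <= t -> t <= 1 -> (h (t *: x + (1 - t) *: y) <= (t * a + (1 - t) * b)%:E)%E.
Proof.
move=> hx hy t0 t1; apply: (le_trans (h_convex x y t0 t1)).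
by rewrite (EFinD (t * a)) !EFinM leeD// lee_wpmul2l// lee_fin ?subr_ge0.
Qed.

(* Closedness at [x0] gives [h >= h x0 - 1] on a ball, and convexity along rays
   from [x0] propagates it with linear decay. *)
Lemma efun_minorant : exists x0 r0 d, 0 < d /\
  h x0 = r0%:E /\ forall y a, (h y <= a%:E)%E -> r0 - 1 - enorm (y - x0) / d <= a.
Proof.
have [x0 hx0] := h_proper.2.
have [[r0 hr0]|/eqP] := efun_fin_or_pinfty x0; last by rewrite (negPf hx0).
pose A := [set p : 'rV[R]_n * R | (h p.1 <= p.2%:E)%E].
have nA : nbhs (x0, r0 - 1) (~` A).
  apply: open_nbhs_nbhs; split; first exact: closed_openC.
  by rewrite /A/= hr0 lee_fin; lra.
move/nbhs_ballP : nA => [e/= e0 hA].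
have near_x0 y : enorm (y - x0) < e -> ~ (h y <= (r0 - 1)%:E)%E.
  move=> hy; apply: (hA (y, r0 - 1)); split => /=; last exact: ballxx.
  rewrite -ball_normE/=; apply: le_lt_trans hy.
  by rewrite -enormN opprB mx_norm_le_enorm.
exists x0, r0, (e / 2); split; first by rewrite divr_gt0.
split=> // y a hy; have d0 : 0 < e / 2 by rewrite divr_gt0.
set s := enorm (y - x0); have s0 : 0 <= s := enorm_ge0 _.
have sd0 : 0 <= s / (e / 2) by rewrite divr_ge0// ltW.
have [se|se] := ltP s e.
  have /negP := near_x0 y se; rewrite -ltNge => /lt_le_trans/(_ hy).
  by rewrite lte_fin; lra.
have sp : 0 < s := lt_le_trans e0 se.
(* This places [t y + (1 - t) x0] at distance [e / 2] from [x0], inside the ball where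
   [h > r0 - 1]. *)
pose t := (e / 2) / s.
have t0 : 0 < t by rewrite divr_gt0.
have t1 : t <= 1 by rewrite ler_pdivrMr// mul1r; lra.
have hx0' : (h x0 <= r0%:E)%E by rewrite hr0.
have := efun_convexW hy hx0' (ltW t0) t1.
have hn : enorm (t *: y + (1 - t) *: x0 - x0) < e.
  have -> : t *: y + (1 - t) *: x0 - x0 = t *: (y - x0).
    by apply/rowP => i; rewrite !mxE; ring.
  by rewrite enormZ gtr0_norm// -/s divfK ?gt_eqF//; lra.
move=> hc; have /negP := near_x0 _ hn; rewrite -ltNge => /lt_le_trans/(_ hc).
rewrite lte_fin => hlt.
have -> : s / (e / 2) = t^-1.
  by rewrite /t [RHS]invf_div.
have : - t^-1 <= a - r0.
  rewrite -(ler_pM2l t0) mulrN divff ?gt_eqF//; lra.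
lra.
Qed.

Let quad z x := c * enorm (x - z) ^+ 2.

Let quad_mid z x y : quad z (2^-1 *: x + (1 - 2^-1) *: y) =
  (quad z x + quad z y) / 2 - c / 4 * enorm (x - y) ^+ 2.
Proof.
rewrite /quad; have -> : 2^-1 *: x + (1 - 2^-1) *: y - z = 2^-1 *: ((x - z) + (y - z)).
  by apply/rowP => i; rewrite !mxE; field.
have -> : x - y = (x - z) - (y - z) by rewrite opprB addrA subrK.
move: (x - z) (y - z) => {}x {}y.
by rewrite !sqr_enorm !dotE (dotC y x); field.
Qed.

(** The objective is bounded below since the quadratic dominates the linear decay of
    [efun_minorant]. By strong convexity at midpoints a minimizing sequence is Cauchy, and
    closedness of the epigraph passes to its limit. Real upper bounds [a] of [h x] stand in for
    extended values. *)
Lemma prox_minimizer z : exists p, exists2 m : R,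
  (h p <= (m - quad z p)%:E)%E &
  forall x a, (h x <= a%:E)%E -> m <= a + quad z x.
Proof.
have [x0 [r0 [d [d0 [hr0 hmin]]]]] := efun_minorant.
pose S := [set v | exists x a, (h x <= a%:E)%E /\ v = a + quad z x].
have S0 : S !=set0 by exists (r0 + quad z x0), x0, r0; rewrite hr0.
have Slb : has_lbound S.
  (* The last term is the minimum of [c s ^ 2 - s / d] over [s], found by completing the square. *)
  exists (r0 - 1 - enorm (z - x0) / d - (4 * c * d ^+ 2)^-1).
  move=> _ [x [a [/hmin ha ->]]].
  have h1 : enorm (x - x0) <= enorm (x - z) + enorm (z - x0).
    by have := enormD (x - z) (z - x0); rewrite subrKA.
  have h2 : enorm (x - x0) / d <= enorm (x - z) / d + enorm (z - x0) / d.
    by rewrite -mulrDl ler_wpM2r// invr_ge0 ltW.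
  have h3 : 0 <= quad z x - enorm (x - z) / d + (4 * c * d ^+ 2)^-1.
    have -> : quad z x - enorm (x - z) / d + (4 * c * d ^+ 2)^-1 =
        c * (enorm (x - z) - (2 * c * d)^-1) ^+ 2.
      by rewrite /quad; field; rewrite !gt_eqF.
    by rewrite mulr_ge0// sqr_ge0.
  lra.
pose m := inf S.
have mle x a : (h x <= a%:E)%E -> m <= a + quad z x.
  by move=> hx; apply: ge_inf => //; exists x, a.
have /choice[xa hxa] : forall k : nat, exists xa : 'rV[R]_n * R,
    (h xa.1 <= xa.2%:E)%E /\ xa.2 + quad z xa.1 < m + k.+1%:R^-1.
  move=> k; have k0 : 0 < k.+1%:R^-1 :> R by rewrite invr_gt0.
  have [_ [x [a [hx ->]]] hlt] := inf_adherent k0 (conj S0 Slb).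
  by exists (x, a).
pose u k := (xa k).1.
have hdist i j : c / 4 * enorm (u i - u j) ^+ 2 <= (i.+1%:R^-1 + j.+1%:R^-1) / 2.
  have [hi hi'] := hxa i; have [hj hj'] := hxa j.
  have h2 : 0 <= 2^-1 :> R by rewrite invr_ge0.
  have h21 : 2^-1 <= 1 :> R by rewrite invf_le1// ler1n.
  have := mle _ _ (efun_convexW hi hj h2 h21); rewrite quad_mid -/(u i) -/(u j).
  move: hi' hj'; rewrite -/(u i) -/(u j).
  move: (quad z (u i)) (quad z (u j)) (enorm _ ^+ 2) => A B C.
  move: (i.+1%:R^-1) (j.+1%:R^-1) (c / 4 * C) => r s D; lra.
have invk (e : R) : 0 < e -> \forall k \near \oo, k.+1%:R^-1 < e.
  by move=> e0; exact: near_infty_natSinv_lt (PosNum e0).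
have ucvg : cvg (u @ \oo).
  apply: cauchy_cvg; apply: cauchy_exP => e e0.
  have e'0 : 0 < c / 4 * e ^+ 2 by rewrite mulr_gt0// ?divr_gt0// exprn_gt0.
  have [N _ hN] := invk _ e'0.
  exists (u N); exists N => // k /= Nk; rewrite -ball_normE/=.
  apply: (le_lt_trans (mx_norm_le_enorm _)).
  have hNk := hdist N k; have hk := hN k Nk; have hNN := hN N (leqnn N).
  rewrite -ltr_sqr ?nnegrE ?enorm_ge0 ?(ltW e0)//.
  have c4 : 0 < c / 4 by rewrite divr_gt0.
  rewrite -(ltr_pM2l c4) (le_lt_trans hNk)//; move: hk hNN.
  move: (N.+1%:R^-1) (k.+1%:R^-1) (c / 4 * e ^+ 2) => r s D; lra.
have [p up] : exists p, u @ \oo --> p by exists (lim (u @ \oo)).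
have near_p (e : R) : 0 < e -> \forall k \near \oo, enorm (p - u k) < e.
  move=> e0; have e'0 : 0 < e / n.+1%:R by rewrite divr_gt0.
  move/cvgrPdist_lt : up => /(_ _ e'0); apply: filterS => k.
  rewrite ltr_pdivlMr// mulrC; exact: le_lt_trans (enorm_le_mx_norm _).
exists p, m => //; apply/negPn/negP => hp.
pose A := [set p : 'rV[R]_n * R | (h p.1 <= p.2%:E)%E].
have : nbhs (p, m - quad z p) (~` A).
  apply: open_nbhs_nbhs; split; first exact: closed_openC.
  exact/negP.
move/nbhs_ballP => [e/= e0 hA].
(* If [p] missed the bound, a ball around [(p, m - quad z p)] would avoid the epigraph. The points
   [(u k, m + k.+1%:R^-1 - quad z (u k))] lie in the epigraph and, by this estimate, eventually in
   that ball. *)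
have hquad k : `|quad z p - quad z (u k)| <=
    c * enorm (p - u k) * (2 * enorm (p - z) + enorm (p - u k)).
  have -> : quad z p - quad z (u k) = c * (dot (p - u k) (2 *: (p - z) - (p - u k))).
    rewrite /quad (_ : u k - z = (p - z) - (p - u k)); last first.
      by apply/rowP => i; rewrite !mxE; ring.
    by rewrite !sqr_enorm; move: (p - z) (p - u k) => a b; rewrite !dotE (dotC a b); ring.
  rewrite normrM gtr0_norm// -mulrA ler_wpM2l//.
  rewrite (le_trans (cauchy_schwarz _ _))// ler_wpM2l ?enorm_ge0//.
  by rewrite (le_trans (enormB _ _))// enormZ gtr0_norm.
pose C := c * (2 * enorm (p - z) + 1) + 1.
have C0 : 0 < C.
  by rewrite ltr_wpDl// mulr_ge0// addr_ge0// mulr_ge0 ?enorm_ge0.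
have e1 : 0 < Num.min 1 (Num.min e (e / (2 * C))).
  by rewrite !lt_min ltr01 e0 divr_gt0// mulr_gt0.
have e2 : 0 < e / 2 by rewrite divr_gt0.
have [k []] : exists k,
    enorm (p - u k) < Num.min 1 (Num.min e (e / (2 * C))) /\ k.+1%:R^-1 < e / 2.
  by apply: (@filter_ex _ \oo); apply: filterI; [exact: near_p|exact: invk].
rewrite !lt_min => /and3P[k1 ke kC] kinv.
apply: (hA (u k, m + k.+1%:R^-1 - quad z (u k))).
  split => /=.
    by rewrite -ball_normE/=; exact: le_lt_trans (mx_norm_le_enorm _) ke.
  rewrite /ball/= (_ : _ - _ = - (quad z p - quad z (u k)) - k.+1%:R^-1);
    last by ring.
  rewrite (le_lt_trans (ler_normB _ _))// normrN.
  have kp : 0 < k.+1%:R^-1 :> R by rewrite invr_gt0.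
  rewrite (gtr0_norm kp).
  have h1 : c * enorm (p - u k) * (2 * enorm (p - z) + enorm (p - u k)) <=
      C * enorm (p - u k).
    rewrite mulrAC ler_wpM2r ?enorm_ge0// /C.
    have := ler_wpM2l c_ge0 (ltW k1); lra.
  have h2 : C * enorm (p - u k) < e / 2.
    have -> : C * enorm (p - u k) = enorm (p - u k) * (2 * C) / 2 by field.
    by rewrite ltr_pM2r// -ltr_pdivlMr// mulr_gt0.
  by rewrite (splitr e) ltrD// (le_lt_trans (hquad k))// (le_lt_trans h1).
have [hk hk'] := hxa k.
by rewrite /A/= (le_trans hk)// lee_fin lerBrDr ltW.
Qed.

(** Existence of a minimizer settles the choice made by [get] and shows that the infimum is real, so
    that [prox] and [moreau] can be handled by real inequalities. *)
Lemma proxP z : exists a, h (prox gamma h z) = a%:E /\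
  moreau gamma h z = a + (2 * gamma)^-1 * enorm (prox gamma h z - z) ^+ 2 /\
  forall x b, (h x <= b%:E)%E ->
    moreau gamma h z <= b + (2 * gamma)^-1 * enorm (x - z) ^+ 2.
Proof.
have [p0 [m0 hp0 hm0]] := prox_minimizer z.
have obj_ge x : (m0%:E <= prox_obj gamma h z x)%E.
  rewrite /prox_obj; have [[a ha]|->] := efun_fin_or_pinfty x;
    last by rewrite addye// leey.
  by rewrite ha -EFinD lee_fin hm0// ha.
have obj_le : (prox_obj gamma h z p0 <= m0%:E)%E.
  have [[a ha]|hp] := efun_fin_or_pinfty p0; last by move: hp0; rewrite hp.
  by move: hp0; rewrite /prox_obj ha -EFinD !lee_fin lerBrDr.
have : forall y, (prox_obj gamma h z (prox gamma h z) <= prox_obj gamma h z y)%E.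
  have : exists p, [set x | forall y, (prox_obj gamma h z x <= prox_obj gamma h z y)%E] p.
    by exists p0 => y; exact: le_trans obj_le (obj_ge y).
  by move/getPex.
set p := prox gamma h z => hp.
have objp : prox_obj gamma h z p = m0%:E.
  by apply/eqP; rewrite eq_le obj_ge (le_trans (hp p0)).
have me : moreau gamma h z = m0.
  rewrite /moreau; suff -> : ereal_inf (range (prox_obj gamma h z)) = m0%:E by [].
  apply/eqP; rewrite eq_le; apply/andP; split.
    by apply: ge_ereal_inf; exists m0%:E => //; exists p.
  by apply: le_ereal_inf_tmp => _ [x _ <-].
have [[a ha]|hpp] := efun_fin_or_pinfty p; last by move: objp; rewrite /prox_obj hpp.
exists a; split=> //; rewrite me; split; last by move=> x b hx; exact: hm0.
by move: objp; rewrite /prox_obj ha -EFinD => -[<-].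
Qed.

(** The minimizer [p] is compared with [p + t (y - p)]. Convexity makes the change of [h] linear in
    [t], while the second-order part of the quadratic disappears as [t] tends to 0; [t] is taken
    with [t D <= gamma e] to make it at most [e]. *)
Lemma prox_subgradient z : exists a, h (prox gamma h z) = a%:E /\
  forall y b, (h y <= b%:E)%E ->
    a + gamma^-1 * dot (z - prox gamma h z) (y - prox gamma h z) <= b.
Proof.
have [a [ha [hm hmin]]] := proxP z; exists a; split => // y b hy.
move: ha hm hmin; set p := prox gamma h z => ha hm hmin.
apply/ler_addgt0Pr => e e0.
have hp : (h p <= a%:E)%E by rewrite ha.
have [v vE] : exists v, v = y - p by exists (y - p).
rewrite -vE; pose D := dot v v; have D0 : 0 <= D := dot_ge0 _.
pose t := Num.min 1 (gamma * e / (D + 1)).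
have t0 : 0 < t by rewrite lt_min ltr01 divr_gt0 ?mulr_gt0//; lra.
have t1 : t <= 1 by rewrite ge_min lexx.
have tD : t * D <= gamma * e.
  apply: le_trans (_ : gamma * e / (D + 1) * (D + 1) <= _);
    last by rewrite divfK// gt_eqF//; lra.
  by rewrite ler_pM ?(ltW t0)// ?ge_min ?lexx ?orbT//; lra.
have := hmin _ _ (efun_convexW hy hp (ltW t0) t1).
rewrite hm (_ : t *: y + (1 - t) *: p - z = (p - z) + t *: v); last first.
  by rewrite vE; apply/rowP => i; rewrite !mxE; ring.
rewrite -[z - p]opprB dotNl; move: (p - z) => w.
rewrite !sqr_enorm !dotE -/D (dotC v w); set F := dot w v.
set W := dot w w => hle.
have {hle} : t * (a - b) <= t * ((2 * gamma)^-1 * (2 * F + t * D)) by lra.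
rewrite ler_pM2l// => hle.
have : (2 * gamma)^-1 * (2 * F + t * D) <= gamma^-1 * F + e.
  have -> : gamma^-1 * F + e = (2 * gamma)^-1 * (2 * F + 2 * (gamma * e)).
    by field; rewrite gt_eqF.
  by rewrite ler_wpM2l//; have := mulr_ge0 (ltW gamma_gt0) (ltW e0); lra.
lra.
Qed.

Lemma prox_firm z w :
  dot (prox gamma h z - prox gamma h w) (prox gamma h z - prox gamma h w)
  <= dot (prox gamma h z - prox gamma h w) (z - w).
Proof.
have [a [ha hp]] := prox_subgradient z; have [b [hb hq]] := prox_subgradient w.
move: (prox gamma h z) (prox gamma h w) ha hb hp hq => p q ha hb hp hq.
have {}hp := hp q b; have {}hq := hq p a.
rewrite hb lexx in hp; rewrite ha lexx in hq.
have {hp hq} := lerD (hp isT) (hq isT).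
rewrite -[q - p]opprB dotNr.
have -> : z - p = (z - w) - (p - q) + (w - q) by apply/rowP => i; rewrite !mxE; ring.
rewrite dotDl dotBl (dotC (p - q) (z - w)) => hpq.
have {hpq} : 0 <= gamma^-1 * (dot (z - w) (p - q) - dot (p - q) (p - q)) by lra.
by rewrite pmulr_rge0 ?invr_gt0// subr_ge0.
Qed.

Lemma prox_nonexpansive z w :
  enorm (prox gamma h z - prox gamma h w) <= enorm (z - w).
Proof.
have := prox_firm z w; set u := _ - _; rewrite -sqr_enorm => hu.
have [->|u0] := eqVneq (enorm u) 0; first exact: enorm_ge0.
have up : 0 < enorm u by rewrite lt_neqAle eq_sym u0 enorm_ge0.
rewrite -(ler_pM2l up) -expr2 (le_trans hu)//; exact: dot_le_enorm.
Qed.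

(** The proximal point of [z] is a competitor in the problem at [w], and the quadratic expands
    exactly. *)
Lemma moreau_upper z w : moreau gamma h w <= moreau gamma h z
  + dot (gamma^-1 *: (z - prox gamma h z)) (w - z) + (2 * gamma)^-1 * dot (w - z) (w - z).
Proof.
have [a [ha [-> _]]] := proxP z; have [_ [_ [_ hmin]]] := proxP w.
have hp : (h (prox gamma h z) <= a%:E)%E by rewrite ha.
apply: (le_trans (hmin _ _ hp)); move: (prox gamma h z) => p.
have -> : p - w = (p - z) - (w - z) by apply/rowP => i; rewrite !mxE; ring.
rewrite -[z - p]opprB; move: (p - z) (w - z) => u v.
rewrite !sqr_enorm !dotE (dotC v u) le_eqVlt; apply/orP; left; apply/eqP.
by field; rewrite gt_eqF.
Qed.

(** [moreau_upper] used in both directions traps the increment. The lower bound carries the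
    candidate gradient at [v + z]; nonexpansiveness of [prox] makes that gradient monotone, so it
    can be replaced by the one at [z]. *)
Lemma moreau_grad z : differentiable (moreau gamma h) z /\
  grad (moreau gamma h) z = gamma^-1 *: (z - prox gamma h z).
Proof.
apply: grad_of_approx => e e0; apply/nbhs0_enormP.
exists (2 * gamma * e); first by rewrite !mulr_gt0.
move=> v hv; have h1 := moreau_upper z (v + z).
have h2 := moreau_upper (v + z) z; have := prox_nonexpansive (v + z) z.
move: (prox gamma h (v + z)) (prox gamma h z) (moreau gamma h (v + z))
  (moreau gamma h z) h1 h2 => q p mv mz.
rewrite addrK (_ : z - (v + z) = - v); last by rewrite opprD addrCA subrr addr0.
rewrite !dotNr dotNl opprK => h1 h2 hqp.
have h3 : dot (gamma^-1 *: (z - p)) v <= dot (gamma^-1 *: (v + z - q)) v.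
  rewrite !dotZl ler_pM2l ?invr_gt0//.
  have -> : v + z - q = (z - p) + (v - (q - p)).
    by apply/rowP => i; rewrite !mxE; ring.
  rewrite (dotDl (z - p)) lerDl dotBl subr_ge0 (le_trans (dot_le_enorm _ _))//.
  by rewrite -sqr_enorm expr2 ler_wpM2r ?enorm_ge0.
have h4 : (2 * gamma)^-1 * dot v v <= e * enorm v.
  rewrite -sqr_enorm expr2 mulrA ler_wpM2r ?enorm_ge0//.
  by rewrite ler_pdivrMl ?mulr_gt0// ltW.
rewrite ler_norml; apply/andP; split; lra.
Qed.

(** With [v = z - p], the vector [v / gamma] is a subgradient of [h] at [p]. Testing it at [p + v]
    gives [|v|^2 / gamma <= G |v|]. *)
Lemma moreau_grad_lipschitz G z : 0 <= G -> real_lipschitz G h ->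
  enorm (z - prox gamma h z) <= gamma * G.
Proof.
move=> G0 [hfin hG]; have [a [ha hp]] := prox_subgradient z.
move: ha hp; set p := prox gamma h z => ha hp.
set v := z - p.
have := hp (p + v) (fine (h (p + v))); rewrite fineK ?hfin// lexx => /(_ isT).
have := hG (p + v) p; rewrite ha/= (addrC p v) addrK -sqr_enorm.
move=> /ler_normlP[_ h1] h2.
have [->|v0] := eqVneq (enorm v) 0; first by rewrite mulr_ge0// ltW.
have vp : 0 < enorm v by rewrite lt_neqAle eq_sym v0 enorm_ge0.
rewrite -ler_pdivrMl// -(ler_pM2r vp) -mulrA -expr2; lra.
Qed.

End Prox.

(** * Gradient rules and convexity criteria *)

Section GradientCalculus.
Context {R : realType} {n : nat}.
Implicit Types (F : 'rV[R]_n -> R) (x y v w z : 'rV[R]_n).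

Lemma gradD F1 F2 x : differentiable F1 x -> differentiable F2 x ->
  differentiable (F1 \+ F2) x /\ grad (F1 \+ F2) x = grad F1 x + grad F2 x.
Proof.
move=> d1 d2; have d12 : differentiable (F1 \+ F2 : _ -> R^o) x.
  exact: differentiableD.
split => //; apply: dot_inj => w.
by rewrite dotDl -!diff_gradE// diffD.
Qed.

Lemma gradZ (c : R) F x : differentiable F x ->
  differentiable (c \*o F) x /\ grad (c \*o F) x = c *: grad F x.
Proof.
move=> dF; have dcF : differentiable (c \*o F : _ -> R^o) x.
  exact: (@differentiableZ _ _ _ (F : _ -> R^o) c x dF).
split => //; apply: dot_inj => w.
by rewrite dotZl -!diff_gradE// (@diffZ _ _ _ (F : _ -> R^o) c x dF).
Qed.

Lemma grad_sqr_enorm x : differentiable (fun z : 'rV[R]_n => enorm z ^+ 2) x /\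
  grad (fun z : 'rV[R]_n => enorm z ^+ 2) x = 2 *: x.
Proof.
apply: grad_of_approx => e e0; apply/nbhs0_enormP; exists e => // h he.
rewrite !sqr_enorm !dotE (dotC h x).
rewrite (_ : _ - _ = dot h h); last by ring.
by rewrite ger0_norm ?dot_ge0// -sqr_enorm expr2 ler_wpM2r ?enorm_ge0// ltW.
Qed.

Lemma convex_setP (A : set 'rV[R]_n) x y (t : R) : convex_set A -> A x -> A y ->
  0 <= t -> t <= 1 -> A (t *: x + (1 - t) *: y).
Proof.
move=> cA Ax Ay t0 t1.
have := cA x y (Itv01 t0 t1); rewrite !inE => /(_ Ax Ay).
by [].
Qed.

Lemma convex_functionP F x y (t : R) : convex_function [set: 'rV[R]_n] F ->
  0 <= t -> t <= 1 -> F (t *: x + (1 - t) *: y) <= t * F x + (1 - t) * F y.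
Proof.
move=> cF t0 t1.
have := cF (Itv01 t0 t1) x y; rewrite !inE => /(_ I I).
by [].
Qed.

(** The mean value theorem is applied from the intermediate point [z] towards [x] and towards [y].
    Both mean points stay in [A] and their difference is a positive multiple of [x - y], so the
    hypothesis compares exactly the two slopes that decide convexity. *)
Lemma mconvex_of_monotone (A : set 'rV[R]_n) F (m : R) : convex_set A ->
  (forall x, differentiable F x) ->
  (forall x y, A x -> A y ->
     m * enorm (x - y) ^+ 2 <= dot (grad F x - grad F y) (x - y)) ->
  mconvex_on m A F.
Proof.
move=> cA dF mono t x y /[!inE] Ax Ay.
pose phi (z : 'rV[R]_n) : R := F z - m / 2 * enorm z ^+ 2.
have hphi z : differentiable phi z /\ grad phi z = grad F z - m *: z.
  have [d1 g1] := grad_sqr_enorm z.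
  have [d2 g2] := gradZ (- (m / 2)) d1.
  have [d3 g3] := gradD (dF z) d2.
  have -> : phi = F \+ (- (m / 2) \*o (fun z : 'rV[R]_n => enorm z ^+ 2)).
    by apply/funext => v; rewrite /phi/= mulNr.
  rewrite g3 g2 g1 scalerA; split => //; congr (_ + _).
  by apply/rowP => i; rewrite !mxE; field.
suff hs (s : R) : 0 <= s -> s <= 1 ->
    phi (s *: x + (1 - s) *: y) <= s * phi x + (1 - s) * phi y.
  exact: (hs t%:num).
move=> s0 s1; pose z : 'rV[R]_n := s *: x + (1 - s) *: y.
have Az : A z by exact: convex_setP.
have dphi v : differentiable phi v := (hphi v).1.
have [r r01 hr] := @segment_MVT _ _ phi z x (fun t _ => dphi _).
have [r' r'01 hr'] := @segment_MVT _ _ phi z y (fun t _ => dphi _).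
have zx : x - z = (1 - s) *: (x - y).
  by apply/rowP => i; rewrite !mxE; ring.
have zy : y - z = - s *: (x - y).
  by apply/rowP => i; rewrite !mxE; ring.
have hc (v : 'rV[R]_n) (q : R) : A v -> 0 < q < 1 -> A (z + q *: (v - z)).
  move=> Av /andP[q0 q1].
  have -> : z + q *: (v - z) = q *: v + (1 - q) *: z.
    by apply/rowP => i; rewrite !mxE; ring.
  exact: convex_setP (ltW q0) (ltW q1).
move: hr hr' (mono _ _ (hc x r Ax r01) (hc y r' Ay r'01)).
rewrite !(hphi _).2 sqr_enorm.
have cc : z + r *: (x - z) - (z + r' *: (y - z)) =
    (r * (1 - s) + r' * s) *: (x - y).
  by rewrite zx zy; apply/rowP => i; rewrite !mxE; ring.
have k0 : 0 < r * (1 - s) + r' * s.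
  case/andP: r01 => r0 _; case/andP: r'01 => r'0 _.
  have [->|sn0] := eqVneq s 0; first by lra.
  have sp : 0 < s by rewrite lt_neqAle eq_sym sn0.
  by rewrite ltr_wpDl ?mulr_gt0// mulr_ge0 ?subr_ge0// ltW.
rewrite cc; have := congr1 (fun v => dot v (x - y)) cc; rewrite /= dotZl dotBl.
rewrite zx zy; move: (r * _ + _) k0 => k k0.
move: (x - y) => d; move: (z + r' *: _) => c2; move: (z + r *: _) => c1.
rewrite !dotZr !dotZl !dotBl !dotZl.
move: (dot (grad F c1) d) (dot (grad F c2) d) (dot c1 d) (dot c2 d) (dot d d).
move=> p1 p2 q1 q2 D hq hx hy.
have -> : m * (k * (k * D)) = k * (m * (k * D)) by ring.
rewrite ler_pM2l// -hq => hm; rewrite -subr_ge0.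
have -> : s * phi x + (1 - s) * phi y - phi z =
    s * (phi x - phi z) + (1 - s) * (phi y - phi z) by ring.
rewrite hx hy.
have -> : s * ((1 - s) * (p1 - m * q1)) + (1 - s) * (- s * (p2 - m * q2)) =
    s * (1 - s) * ((p1 - p2) - m * (q1 - q2)) by ring.
by rewrite mulr_ge0 ?subr_ge0// mulr_ge0 ?subr_ge0.
Qed.

Lemma convex_grad_ge F x y : convex_function [set: 'rV[R]_n] F ->
  differentiable F x -> F x + dot (grad F x) (y - x) <= F y.
Proof.
move=> cF dF; apply/ler_addgt0Pr => e e0.
set N := enorm (y - x); have N0 : 0 <= N := enorm_ge0 _.
have e'0 : 0 < e / (N + 1) by rewrite divr_gt0//; lra.
have /nbhs0_enormP[d d0 hd] := grad_approx dF e'0.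
pose t := Num.min 1 (d / (N + 1) / 2).
have dN : 0 < d / (N + 1) / 2 by rewrite !divr_gt0//; lra.
have t0 : 0 < t by rewrite lt_min ltr01.
have t1 : t <= 1 by rewrite ge_min lexx.
have htd : enorm (t *: (y - x)) < d.
  rewrite enormZ gtr0_norm//; apply: le_lt_trans (_ : d / (N + 1) / 2 * (N + 1) < _).
    have tle : t <= d / (N + 1) / 2 by rewrite /t ge_min lexx orbT.
    by rewrite ler_pM ?(ltW t0)// lerDl.
  have -> : d / (N + 1) / 2 * (N + 1) = d / 2 by field; rewrite gt_eqF//; lra.
  lra.
have := hd _ htd; rewrite dotZr enormZ (gtr0_norm t0) -/N.
move=> /ler_normlP[hle _].
have := convex_functionP y x cF (ltW t0) t1.
have -> : t *: y + (1 - t) *: x = t *: (y - x) + x.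
  by apply/rowP => i; rewrite !mxE; ring.
move=> hc; rewrite -(ler_pM2l t0).
have h3 : e / (N + 1) * (t * N) <= t * e.
  have -> : e / (N + 1) * (t * N) = t * e * (N / (N + 1)) by ring.
  have hN1 : N / (N + 1) <= 1 by rewrite ler_pdivrMr ?mul1r//; lra.
  by rewrite ler_piMr// mulr_ge0// ltW.
lra.
Qed.

Lemma subgradient_grad F x v : differentiable F x ->
  (forall y, F x + dot v (y - x) <= F y) -> v = grad F x.
Proof.
move=> dF hv; apply/eqP; rewrite -subr_eq0; apply/eqP/enorm_eq0/eqP.
set w := v - grad F x; rewrite eq_le enorm_ge0 andbT.
apply/ler_addgt0Pr => e e0; rewrite add0r.
have [->|w0] := eqVneq (enorm w) 0; first exact: ltW.
have wp : 0 < enorm w by rewrite lt_neqAle eq_sym w0 enorm_ge0.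
have /nbhs0_enormP[d d0 hd] := grad_approx dF e0.
pose t := d / 2 / enorm w.
have t0 : 0 < t by rewrite !divr_gt0.
have htd : enorm (t *: w) = d / 2 by rewrite enormZ gtr0_norm// divfK.
have := hd (t *: w); rewrite htd => /(_ _)/ler_normlP[|_]; first by lra.
have := hv (t *: w + x); rewrite addrK => h1 h2.
have : dot w (t *: w) <= e * (d / 2) by rewrite {1}/w dotBl; lra.
rewrite dotZr -sqr_enorm expr2 mulrA (_ : t * enorm w = d / 2).
  by rewrite mulrC ler_pM2r// divr_gt0.
by rewrite divfK.
Qed.

(** Serves [proxf_jacobian]: the lower bound by [mu] is available only on [Omega_f], but the
    Douglas-Rachford envelope must be differentiable everywhere. *)
Lemma hessian_psd F x : convex_function [set: 'rV[R]_n] F ->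
  (forall z, differentiable F z) -> differentiable (grad F) x ->
  loewner_le 0%:M (hessian F x).
Proof.
move=> cF dF dG v; rewrite (_ : 0%:M = 0) ?subr0; last first.
  by apply/matrixP => i j; rewrite !mxE mul0rn.
set A := hessian F x.
have mono h : 0 <= dot (grad F (h + x) - grad F x) h.
  have := convex_grad_ge (h + x) cF (dF x).
  have := convex_grad_ge x cF (dF (h + x)).
  by rewrite (_ : x - (h + x) = - h) ?addrK ?dotNr ?dotBl; [lra|rewrite opprD addrCA subrr addr0].
apply/ler_addgt0Pr => e e0; set N := dot v v; have N0 : 0 <= N := dot_ge0 _.
have e'0 : 0 < e / (N + 1) by rewrite divr_gt0//; lra.
have /nbhs0_enormP[d d0 hd] := jacobian_approx dG e'0.
pose t := d / 2 / (enorm v + 1).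
have vp : 0 < enorm v + 1 by have := enorm_ge0 v; lra.
have t0 : 0 < t by rewrite !divr_gt0.
have htd : enorm (t *: v) < d.
  rewrite enormZ gtr0_norm//; apply: lt_le_trans (_ : t * (enorm v + 1) <= _).
    by rewrite ltr_pM2l//; lra.
  by rewrite divfK ?gt_eqF//; lra.
have := hd _ htd; set r := _ - _ => hr.
have := mono (t *: v).
have -> : grad F (t *: v + x) - grad F x = r + t *: (v *m A).
  by rewrite /r scalemxAl opprD addrA subrK.
rewrite dotDl dotZl !dotZr => hm.
have h1 : dot r v <= e / (N + 1) * (t * N).
  have NE : N = enorm v * enorm v by rewrite -expr2 sqr_enorm.
  rewrite (le_trans (dot_le_enorm _ _))// [X in t * X]NE.
  rewrite (mulrA t) (mulrA (e / (N + 1))) ler_wpM2r ?enorm_ge0//.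
  by rewrite (le_trans hr)// enormZ (gtr0_norm t0).
have h2 : e / (N + 1) * (t * N) <= t * e.
  have -> : e / (N + 1) * (t * N) = t * e * (N / (N + 1)) by ring.
  have hN1 : N / (N + 1) <= 1 by rewrite ler_pdivrMr ?mul1r//; lra.
  by rewrite ler_piMr// mulr_ge0// ltW.
have {hm} : 0 <= t * (dot r v + t * dot (v *m A) v) by lra.
rewrite pmulr_rge0// => hm.
have : 0 <= t * (e + dot (v *m A) v) by lra.
by rewrite pmulr_rge0// addrC.
Qed.

End GradientCalculus.

(** * The two envelopes and their gradients *)

Section Envelopes.
Context {R : realType} {n : nat}.
Variables (f : 'rV[R]_n -> R) (g : 'rV[R]_n -> \bar R) (mu L gamma : R).
Hypotheses (f_convex : convex_function [set: 'rV[R]_n] f)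
  (f_diff : forall x, differentiable f x)
  (df_diff : forall x, differentiable (grad f) x)
  (g_proper : proper_efun g) (g_closed : closed_efun g) (g_convex : convex_efun g)
  (gamma_gt0 : 0 < gamma).
Implicit Types (x y v w : 'rV[R]_n).

Let A x := hessian f x.
Let T x := x - gamma *: grad f x.
Let P x := prox gamma g (T x).

(** The chain rule gives [(grad f x + (T x - P x) / gamma) (1 - gamma A)], and the gradient of [f]
    cancels against the one inside [T x]. *)
Lemma FBE_grad x : differentiable (FBE gamma f g) x /\
  grad (FBE gamma f g) x = gamma^-1 *: ((x - P x) *m (1%:M - gamma *: A x)).
Proof.
have sA : (A x)^T = A x by exact: hessian_sym.
have [dT JT] : differentiable T x /\ 'J T x = 1%:M - gamma *: A x.
  apply: jacobian_of_approx => e e0.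
  have e'0 : 0 < e / gamma by rewrite divr_gt0.
  apply: filterS (jacobian_approx (df_diff x) e'0) => h.
  rewrite -/(hessian f x) -/(A x) => hh.
  have -> : T (h + x) - (T x + h *m (1%:M - gamma *: A x)) =
      - gamma *: (grad f (h + x) - (grad f x + h *m A x)).
    rewrite /T mulmxBr mulmx1 -scalemxAr.
    by apply/rowP => i; rewrite !mxE; ring.
  rewrite enormZ normrN gtr0_norm// -ler_pdivlMl// (le_trans hh)//.
  by rewrite mulrA (mulrC e).
have sQ : (1%:M - gamma *: A x)^T = 1%:M - gamma *: A x.
  by rewrite linearB/= linearZ/= trmx1 sA.
have [d1 g1] := grad_sqr_enorm (grad f x).
have [d2 g2] := grad_comp (df_diff x) d1.
have [d3 g3] := gradZ (- (gamma / 2)) d2.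
have [d4 g4] := gradD (f_diff x) d3.
have [d5 g5] := moreau_grad g_proper g_closed g_convex gamma_gt0 (T x).
have [d6 g6] := grad_comp dT d5.
have [d7 g7] := gradD d4 d6.
have -> : FBE gamma f g = (f \+ (- (gamma / 2) \*o
    ((fun z : 'rV[R]_n => enorm z ^+ 2) \o grad f))) \+ (moreau gamma g \o T).
  by apply/funext => v; rewrite /FBE/= mulNr.
split=> //; rewrite g7 g6 g5 g4 g3 g2 g1 JT.
rewrite -/(hessian f x) -/(A x) sQ sA.
rewrite -/(P x) /T; move: (P x) (grad f x) (A x) => p G B.
rewrite !(mulmxBr, mulmx1, mulmxBl, mulmxDl) -!scalemxAr.
rewrite -!scalemxAl !(mulmxBl, mulmxDl) -!scalemxAl.
move: (p *m B) (G *m B) (x *m B) => pB GB xB.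
by apply/rowP => i; rewrite !mxE; field; rewrite gt_eqF.
Qed.

Let pf := prox gamma (EFin \o f).

Lemma efun_of_real : [/\ proper_efun (EFin \o f), closed_efun (EFin \o f)
  & convex_efun (EFin \o f)].
Proof.
split.
- by split => //; exists 0.
- rewrite /closed_efun; set S := [set _ | _].
  have -> : S = [set p : 'rV[R]_n * R | 0 <= p.2 - f p.1].
    by apply/seteqP; split => p /=; rewrite /S/= lee_fin subr_ge0.
  apply: (@preimage_closed _ _ (fun p : 'rV[R]_n * R => p.2 - f p.1) [set x | 0 <= x]).
    move=> p _; apply: cvgB; first exact: cvg_snd.
    apply: (@cvg_comp _ _ _ fst f _ (nbhs p.1)); first exact: cvg_fst.
    exact: (differentiable_continuous (f_diff p.1)).
  exact: closed_ge.
- by move=> x y t t0 t1; rewrite /= -!EFinM -EFinD lee_fin; exact: convex_functionP.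
Qed.

Lemma proxf_eq x : pf x + gamma *: grad f (pf x) = x.
Proof.
have [fp fc fv] := efun_of_real.
have [a [[<-] hp]] := prox_subgradient fp fc fv gamma_gt0 x.
have : gamma^-1 *: (x - pf x) = grad f (pf x).
  apply: subgradient_grad => // y; rewrite dotZl.
  by have := hp y (f y); rewrite lexx; apply.
move=> <-; rewrite scalerA divff ?gt_eqF// scale1r; exact: subrKC.
Qed.

(** [grad f] is assumed differentiable but not [C^1], so the inverse function theorem is replaced by
    a direct argument: [pf] inverts [q + gamma grad f q] and is 1-Lipschitz, hence the remainder of
    [grad f] at [pf x] is also small relative to [h], and applying the resolvent to the expansion of
    [h] isolates [q - p]. *)
Lemma proxf_jacobian x : differentiable pf x /\
  'J pf x = resolvent gamma (A (pf x)).
Proof.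
have [fp fc fv] := efun_of_real.
have g0 : 0 <= gamma := ltW gamma_gt0.
apply: jacobian_of_approx => e e0.
have e'0 : 0 < e / gamma by rewrite divr_gt0.
have /nbhs0_enormP[d d0 hd] := jacobian_approx (df_diff (pf x)) e'0.
apply/nbhs0_enormP; exists d => // h hhd.
have := prox_nonexpansive fp fc fv gamma_gt0 (h + x) x; rewrite -/pf addrK.
have := proxf_eq (h + x); have := proxf_eq x.
have psdA := hessian_psd f_convex f_diff (df_diff (pf x)).
move: hd; rewrite -/(A (pf x)) -/(hessian f (pf x)) -/(A (pf x)).
move: psdA; rewrite -/(A (pf x)).
move: (A (pf x)) => B; move: (pf x) (pf (h + x)) => p q psdB hd hp hq hqp.
have := hd (q - p) (le_lt_trans hqp hhd); rewrite subrK.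
set r := _ - _ => hr.
have hE : h = (q - p) *m (1%:M + gamma *: B) + gamma *: r.
  have -> : h = q + gamma *: grad f q - (p + gamma *: grad f p).
    by rewrite hq hp addrK.
  rewrite /r mulmxDr mulmx1 -scalemxAr. move: ((q - p) *m _) => E.
  by apply/rowP => i; rewrite !mxE; ring.
rewrite {1}hE mulmxDl (mulmx_resolventK (lexx 0) g0 _ psdB).
have -> : q - (p + (q - p + gamma *: r *m resolvent gamma B)) =
    - (gamma *: (r *m resolvent gamma B)).
  by rewrite -scalemxAl; move: (_ *: (r *m _)) => u; apply/rowP => i; rewrite !mxE; ring.
rewrite enormN enormZ gtr0_norm// -ler_pdivlMl//.
have := enorm_resolvent (lexx 0) g0 r psdB; rewrite mulr0 addr0 divr1.
move=> /le_trans; apply; apply: (le_trans hr).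
rewrite [leRHS]mulrA (mulrC gamma^-1) ler_wpM2l//.
by rewrite divr_ge0// ltW.
Qed.

(** With [q = pf x] and [G = grad f q], optimality reads [x - q = gamma G]. The envelope of [f] at
    [x] is then [f q + gamma / 2 |G|^2] with gradient [G], and [x - 2 gamma G = q - gamma G]. *)
Lemma DRE_FBE : DRE gamma f g = FBE gamma f g \o pf.
Proof.
have [fp fc fv] := efun_of_real.
apply/funext => x; have [_ hG] := moreau_grad fp fc fv gamma_gt0 x.
have [a [[<-] [hm _]]] := proxP fp fc fv gamma_gt0 x.
rewrite /DRE hG hm -/pf; have := proxf_eq x; rewrite /FBE /=.
move: (pf x) => q; set G := grad f q => hx.
have xq : x - q = gamma *: G by rewrite -hx addrC addKr.
have -> : gamma^-1 *: (x - q) = G.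
  by rewrite xq scalerA mulVf ?gt_eqF// scale1r.
have -> : x - (2 * gamma) *: G = q - gamma *: G.
  by rewrite -hx; apply/rowP => i; rewrite !mxE; ring.
rewrite enormBC xq enormZ (gtr0_norm gamma_gt0).
by congr (_ + _); field; rewrite gt_eqF.
Qed.

Lemma DRE_grad x : differentiable (DRE gamma f g) x /\
  grad (DRE gamma f g) x = gamma^-1 *: ((pf x - P (pf x)) *m cayley gamma gamma (A (pf x))).
Proof.
have sA : (A (pf x))^T = A (pf x) by exact: hessian_sym.
have [dp Jp] := proxf_jacobian x.
have [dF gF] := FBE_grad (pf x).
have [dDR gDR] := grad_comp dp dF.
rewrite DRE_FBE; split=> //; rewrite gDR gF Jp (trmx_resolvent _ sA).
by rewrite -scalemxAl -mulmxA.
Qed.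

Variables (Of O : set 'rV[R]_n) (tau H K : R) (p : 'rV[R]_n -> 'rV[R]_n)
  (F : 'rV[R]_n -> R).
Hypotheses (mu_ge0 : 0 <= mu) (mu_le_L : mu <= L) (gammaL : gamma * L <= 1)
  (tau_ge0 : 0 <= tau) (H_ge0 : 0 <= H) (cOf : convex_set Of) (cO : convex_set O).
Hypotheses (bA : forall x, Of x -> loewner_le mu%:M (A x) /\ loewner_le (A x) L%:M)
  (lipA : forall x y w, Of x -> Of y ->
     enorm (w *m (A x - A y)) <= H * enorm (x - y) * enorm w)
  (* For a quadratic [f], [H = 0] makes this hold with [K = 0] although the
     residual [x - P x] is unbounded. *)
  (hK : forall x, Of x -> H * enorm (x - P x) <= gamma * K)
  (pE : forall x, p x + tau *: grad f (p x) = x)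
  (pO : forall x, O x -> Of (p x))
  (F_grad : forall x, differentiable F x /\
     grad F x = gamma^-1 *: ((p x - P (p x)) *m cayley tau gamma (A (p x)))).

(** [m] is any number admissible at both ends of the spectrum, in division-free form; taking the
    minimum of the two endpoint values gives the stated constants for either [tau]. *)
Lemma envelope_smooth_mconvex m : 0 <= m ->
  m * (1 + tau * mu) ^+ 2 <= mu * (1 - gamma * mu) ->
  m * (1 + tau * L) ^+ 2 <= L * (1 - gamma * L) ->
  smooth_on ((1 - gamma * mu) / (gamma * (1 + tau * mu) ^+ 2)
             + (gamma + tau) * K / (1 + tau * mu) ^+ 3) O F /\
  mconvex_on (m - (gamma + tau) * K / (1 + tau * mu) ^+ 3) O F.
Proof.
move=> m0 hmu hL.
have dF x := (F_grad x).1.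
have scale a v : H * a <= gamma * K ->
    H * enorm v / 2 * a <= gamma * K * enorm v / 2.
  by move/(ler_wpM2r (enorm_ge0 v)); lra.
suff hgap x y : O x -> O y ->
    enorm (grad F x - grad F y) <=
      ((1 - gamma * mu) / (gamma * (1 + tau * mu) ^+ 2)
             + (gamma + tau) * K / (1 + tau * mu) ^+ 3) * enorm (x - y) /\
    (m - (gamma + tau) * K / (1 + tau * mu) ^+ 3) * enorm (x - y) ^+ 2 <=
      dot (grad F x - grad F y) (x - y).
  split; first by split=> // x y Ox Oy; have [] := hgap x y Ox Oy.
  by apply: mconvex_of_monotone => // x y Ox Oy; have [] := hgap x y Ox Oy.
move=> Ox Oy; rewrite !(F_grad _).2.
(* The segment joins images under [p], and the image of [O] may fail to be convex; convexity of [Of]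
   is what keeps it in the region of Hessian bounds. *)
have Ofz (t : R) : 0 <= t <= 1 -> Of (p y + t *: (p x - p y)).
  move=> /andP[t0 t1].
  have -> : p y + t *: (p x - p y) = t *: p x + (1 - t) *: p y.
    by apply/rowP => i; rewrite !mxE; ring.
  by apply: convex_setP => //; exact: pO.
have bS x' : Of x' -> bounded_sym mu L (A x').
  by move=> Ox'; have [h1 h2] := bA Ox'; split=> //; exact: hessian_sym.
have [M [bM eM Mx My]] := @mean_jacobian R n (grad f) A (p x) (p y) mu L H H_ge0
  df_diff (fun=> erefl) (fun t t01 => bS _ (Ofz t t01))
  (fun s t w s01 t01 => lipA w (Ofz s s01) (Ofz t t01)).
have dE : (p x - p y) *m (1%:M + tau *: M) = x - y.
  have -> : x - y = p x + tau *: grad f (p x) - (p y + tau *: grad f (p y)).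
    by rewrite !pE.
  rewrite mulmx_shift eM.
  move: (p x) (p y) (grad f (p x)) (grad f (p y)) => *.
  by apply/rowP => i; rewrite !mxE; ring.
have hu := prox_firm g_proper g_closed g_convex gamma_gt0 (T (p x)) (T (p y)).
rewrite (_ : T (p x) - T (p y) = (p x - p y) *m (1%:M - gamma *: M)) in hu; last first.
  rewrite -scaleNr mulmx_shift eM /T.
  move: (p x) (p y) (grad f (p x)) (grad f (p y)) => *.
  by apply/rowP => i; rewrite !mxE; ring.
have abE : (p x - P (p x)) - (p y - P (p y)) = (p x - p y) - (P (p x) - P (p y)).
  move: (p x) (p y) (P (p x)) (P (p y)) => *.
  by apply/rowP => i; rewrite !mxE; ring.
have h0 : 0 <= H * enorm (p x - p y) / 2.
  by rewrite !mulr_ge0 ?enorm_ge0.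
have ha z : Of z -> H * enorm (p x - p y) / 2 * enorm (z - P z) <=
    gamma * K * enorm (p x - p y) / 2.
  by move=> /hK; exact: scale.
have [muAx _] := bA (pO Ox); have [muAy _] := bA (pO Oy).
have hx := ha _ (pO Ox); have hy := ha _ (pO Oy).
split.
  by have := gradient_gap_le mu_ge0 mu_le_L tau_ge0 gamma_gt0 gammaL bM hu
    muAx muAy Mx My h0 abE hx hy; rewrite dE.
by have := gradient_gap_ge mu_ge0 mu_le_L tau_ge0 gamma_gt0 bM hu
  muAx muAy Mx My h0 abE hx hy m0 hmu hL; rewrite dE.
Qed.

End Envelopes.

(** * Specialization to the two envelopes and the two cases *)

Lemma enorm_mulmx_opnorm (R : realType) (n : nat) (A : 'M[R]_n) (c : R)
  (w : 'rV[R]_n) : opnorm A <= c -> enorm (w *m A) <= c * enorm w.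
Proof.
move=> Ac; have [w0|w0] := eqVneq (enorm w) 0.
  by rewrite w0 (enorm_eq0 w0) mul0mx enorm0 mulr0.
have wp : 0 < enorm w by rewrite lt_neqAle eq_sym w0 enorm_ge0.
rewrite -ler_pdivrMr// (le_trans _ Ac)//.
have -> : enorm (w *m A) / enorm w = enorm ((enorm w)^-1 *: w *m A).
  by rewrite -scalemxAl enormZ gtr0_norm ?invr_gt0// mulrC.
apply: ub_le_sup; last first.
  by exists ((enorm w)^-1 *: w) => //=; rewrite enormZ gtr0_norm ?invr_gt0// mulVf.
(* A supremum bounds its set only when the set is bounded above; the sum of the row norms is such a
   bound on the unit ball. *)
exists (\sum_i enorm (row i A)) => _ [v /= v1 <-].
have -> : v *m A = \sum_i v 0 i *: row i A by exact: mulmx_sum_row.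
apply: le_trans (_ : \sum_i enorm (v 0 i *: row i A) <= _).
  elim/big_ind2 : _ => [|x a y b xa yb|//]; first by rewrite enorm0.
  by rewrite (le_trans (enormD _ _))// lerD.
apply: ler_sum => i _; rewrite enormZ ler_piMl ?enorm_ge0//.
exact: le_trans (coord_le_enorm v i) v1.
Qed.

Lemma cayley0 (R : realType) (n : nat) (gamma : R) (A : 'M[R]_n) :
  cayley 0 gamma A = 1%:M - gamma *: A.
Proof. by rewrite /cayley /resolvent scale0r addr0 invmx1 mulmx1. Qed.

(** Common form of both cases: the bounds on [grad f] and on the slope of [g] enter only through [H]
    times the residual. Case (A) takes [K = H (D + G)], case (B) takes [H = K = 0] on the whole
    space. *)
Lemma envelopes_smooth_mconvex (R : realType) (n : nat)
    (f : 'rV[R]_n -> R) (g : 'rV[R]_n -> \bar R) (mu L gamma H K : R)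
    (Omega_f Omega : set 'rV[R]_n) :
  convex_function [set: 'rV[R]_n] f -> twice_differentiable f ->
  proper_efun g -> closed_efun g -> convex_efun g ->
  0 <= mu -> mu <= L -> 0 < gamma -> gamma * L <= 1 -> 0 <= H ->
  convex_set Omega_f -> convex_set Omega ->
  (forall x, Omega_f x ->
    loewner_le mu%:M (hessian f x) /\ loewner_le (hessian f x) L%:M) ->
  (forall x y w, Omega_f x -> Omega_f y ->
    enorm (w *m (hessian f x - hessian f y)) <= H * enorm (x - y) * enorm w) ->
  (forall x, Omega_f x ->
    H * enorm (x - prox gamma g (x - gamma *: grad f x)) <= gamma * K) ->
  (Omega `<=` Omega_f ->
     smooth_on (L_FB mu gamma K) Omega (FBE gamma f g) /\
     mconvex_on (mu_FB mu L gamma K) Omega (FBE gamma f g)) /\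
  (prox gamma (EFin \o f) @` Omega `<=` Omega_f ->
     smooth_on (L_DR mu gamma K) Omega (DRE gamma f g) /\
     mconvex_on (mu_DR mu L gamma K) Omega (DRE gamma f g)).
Proof.
move=> cf [df ddf] pg cg vg mu0 muL g0 gL H0 cOf cO bA lipA hK.
have L0 : 0 <= L := le_trans mu0 muL.
have g0' := ltW g0.
have gmu : gamma * mu <= 1 by apply: le_trans gL; rewrite ler_pM2l.
have m0 : 0 <= mu * (1 - gamma * mu) by rewrite mulr_ge0 ?subr_ge0.
have l0 : 0 <= L * (1 - gamma * L) by rewrite mulr_ge0 ?subr_ge0.
split=> hO.
  rewrite /L_FB /mu_FB; set m := Num.min _ _.
  have := @envelope_smooth_mconvex R n f g mu L gamma df ddf pg cg vg g0
    Omega_f Omega 0 H K id (FBE gamma f g) mu0 muL gL (lexx 0) H0 cOf cO bA lipA hK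
    _ _ _ m _ _ _.
  rewrite !mul0r !addr0 !expr1n !mulr1 !divr1; apply.
  - by move=> x; rewrite scale0r addr0.
  - exact: hO.
  - by move=> x; rewrite cayley0; exact: FBE_grad.
  - by rewrite le_min m0.
  - by rewrite ge_min lexx.
  - by rewrite ge_min lexx orbT.
rewrite /L_DR /mu_DR; set m := Num.min _ _.
have dmu : 0 < (1 + gamma * mu) ^+ 2 by rewrite exprn_gt0// ltr_wpDr// mulr_ge0.
have dL : 0 < (1 + gamma * L) ^+ 2 by rewrite exprn_gt0// ltr_wpDr// mulr_ge0.
have := @envelope_smooth_mconvex R n f g mu L gamma df ddf pg cg vg g0
  Omega_f Omega gamma H K (prox gamma (EFin \o f)) (DRE gamma f g)
  mu0 muL gL g0' H0 cOf cO bA lipA hK _ _ _ m _ _ _.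
rewrite (_ : gamma + gamma = 2 * gamma); last by rewrite mulr2n mulrDl mul1r.
apply.
- by move=> x; exact: proxf_eq.
- by move=> x Ox; apply: hO; exists x.
- by move=> x; exact: DRE_grad.
- by rewrite le_min (divr_ge0 m0 (ltW dmu)) (divr_ge0 l0 (ltW dL)).
- by rewrite -ler_pdivlMr// ge_min lexx.
- by rewrite -ler_pdivlMr// ge_min lexx orbT.
Qed.

Theorem theorem4p6 (R : realType) (n : nat)
    (f : 'rV[R]_n -> R) (g : 'rV[R]_n -> \bar R) (mu L gamma : R)
    (f_convex : convex_function [set: 'rV[R]_n] f)
    (f_twice_diff : twice_differentiable f)
    (f_smooth : smooth_on L [set: 'rV[R]_n] f)
    (g_proper : proper_efun g) (g_closed : closed_efun g) (g_convex : convex_efun g)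
    (mu_ge0 : 0 <= mu) (mu_le_L : mu <= L) (L_gt0 : 0 < L)
    (gamma_gt0 : 0 < gamma) (gamma_le : gamma <= 1 / L) :
  (* case (A) *)
  (forall (Omega_f Omega : set 'rV[R]_n) (H D G : R),
     convex_set Omega_f -> convex_set Omega ->
     0 <= H -> 0 <= D -> 0 <= G ->
     (forall x, Omega_f x ->
        [/\ loewner_le mu%:M (hessian f x), loewner_le (hessian f x) L%:M
          & enorm (grad f x) <= D]) ->
     (forall x y, Omega_f x -> Omega_f y ->
        opnorm (hessian f x - hessian f y) <= H * enorm (x - y)) ->
     real_lipschitz G g ->
     (Omega `<=` Omega_f ->
        smooth_on (L_FB mu gamma (H * (D + G))) Omega (FBE gamma f g) /\
        mconvex_on (mu_FB mu L gamma (H * (D + G))) Omega (FBE gamma f g)) /\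
     (prox gamma (EFin \o f) @` Omega `<=` Omega_f ->
        smooth_on (L_DR mu gamma (H * (D + G))) Omega (DRE gamma f g) /\
        mconvex_on (mu_DR mu L gamma (H * (D + G))) Omega (DRE gamma f g))) /\
  (* case (B) *)
  (forall Q : 'M[R]_n,
     quadratic f -> (forall x, hessian f x = Q) ->
     loewner_le mu%:M Q -> loewner_le Q L%:M ->
     (smooth_on (L_FB mu gamma 0) [set: 'rV[R]_n] (FBE gamma f g) /\
      mconvex_on (mu_FB mu L gamma 0) [set: 'rV[R]_n] (FBE gamma f g)) /\
     (smooth_on (L_DR mu gamma 0) [set: 'rV[R]_n] (DRE gamma f g) /\
      mconvex_on (mu_DR mu L gamma 0) [set: 'rV[R]_n] (DRE gamma f g))).
Proof.
have gL : gamma * L <= 1 by rewrite -ler_pdivlMr.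
split=> [ Omega_f Omega H D G cOf cO H0 D0 G0 hA hH hG|Q _ hQ muQ QL].
  apply: (envelopes_smooth_mconvex (H := H)) => //.
  - by move=> x /hA[].
  - by move=> x y w Ox Oy; apply: enorm_mulmx_opnorm; exact: hH.
  - move=> x /hA[_ _ hD]; rewrite mulrCA ler_wpM2l// mulrDr.
    set z := x - gamma *: grad f x.
    (* The residual splits into the gradient step, at most [gamma * D], and the proximal step, at
       most [gamma * G]. *)
    have -> : x - prox gamma g z = gamma *: grad f x + (z - prox gamma g z).
      by rewrite /z addrA subrKC.
    rewrite (le_trans (enormD _ _))// lerD//.
      by rewrite enormZ gtr0_norm// ler_pM2l.
    exact: moreau_grad_lipschitz.
(* A constant Hessian is Lipschitz with constant 0, so the residual condition reduces to
   [0 <= 0]. *)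
have [] := @envelopes_smooth_mconvex R n f g mu L gamma 0 0 setT setT => //.
- by move=> x _; rewrite hQ; split.
- by move=> x y w _ _; rewrite !hQ subrr mulmx0 enorm0 !mul0r.
- by move=> x _; rewrite mul0r mulr0.
- by move=> h1 h2; split; [apply: h1|apply: h2].
Qed.
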